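(* Let $\mathbf{A}\in\mathbb{C}^{n\times n}$ be Hermitian with $\|\mathbf{A}\|\le1$ and $\epsilon\in(0,1/2)$. Algorithm $\mathsf{EVALSH}(\mathbf{A},\epsilon)$: set $\Phi=16$, $\mathbf{A}'=\mathbf{A}/\Phi$, $\epsilon'=\epsilon/\Phi$, $\gamma=\epsilon'/16$; compute $\widetilde{\mathbf{X}}=\mathsf{SHATTERH}(\mathbf{A}',\gamma)$; set $\delta_{\mathsf{EIG}}=\frac14\cdot\frac{\gamma}{2n^3}$; compute $[\mathbf{V},\mathbf{D}]=\mathsf{EIG}(\widetilde{\mathbf{X}},\delta_{\mathsf{EIG}})$; return $\widetilde\lambda_i=\Phi\cdot\mathrm{Re}(\mathbf{D}_{i,i})$, $i=1,\dots,n$. With probability at least $1-17/n$, when both the eigenvalues $\lambda_i(\mathbf{A})$ and the returned values $\widetilde\lambda_i$ are listed in nondecreasing order, $|\lambda_i(\mathbf{A})-\widetilde\lambda_i|\le\epsilon$ for all $i\in[n]$. The algorithm requires $O(\log^4(n/\epsilon)\log n)$ bits of precision (i.e. the guarantee holds when $\log(1/\mathbf{u})$ is of this order) and has arithmetic complexity $O(T_{\mathsf{MM}}(n)\log^2(n/\epsilon))$.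
   Context: Floating point model with unit roundoff $\mathbf{u}$: $\mathrm{fl}(a\odot b)=(1+\delta)(a\odot b)$, $|\delta|\le\mathbf{u}$, for $\odot\in\{+,-,\times,/\}$ and for stored numbers. $T_{\mathsf{MM}}(n)=O(n^{\omega+\eta})$ is the cost of a numerically stable fast matrix multiplication (for any fixed $\eta>0$, $\omega$ the matrix multiplication exponent). $\mathsf{SHATTERH}(\mathbf{A}',\gamma)$: sample each $\widetilde{\mathbf{Z}}_{i,j}$ with a $c_{\mathsf{N}}$-stable Gaussian sampler with parameter $1/(2n)$ (outputs within $c_{\mathsf{N}}\sigma\mathbf{u}$ of an $N_{\mathbb{C}}(0,\sigma^2)$ sample), and return $\mathrm{fl}(\mathbf{A}'+\mathrm{fl}(\gamma\,\mathrm{fl}(\widetilde{\mathbf{Z}}+\widetilde{\mathbf{Z}}^* )))$. $\mathsf{EIG}$ is a randomized algorithm which, given $\mathbf{M}\in\mathbb{C}^{n\times n}$ with $\|\mathbf{M}\|\le1$ and $\delta>0$, outputs diagonal $\mathbf{D}$ and invertible $\mathbf{V}$ with $\|\mathbf{M}-\mathbf{V}\mathbf{D}\mathbf{V}^{-1}\|\le\delta$ and $\|\mathbf{V}\|\|\mathbf{V}^{-1}\|\le 32n^{2.5}/\delta$, using $O(T_{\mathsf{MM}}(n)\log^2(n/\delta))$ arithmetic operations with $O(\log^4(n/\delta)\log n)$ bits of precision, succeeding with probability at least $1-14/n$. $\|\cdot\|$ is the spectral norm. *)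

(* Defs.v *)
From HB Require Import structures.
From mathcomp Require Import all_boot all_order all_algebra.
From mathcomp Require Import complex.
From mathcomp Require Import all_classical all_reals all_analysis.

Set Implicit Arguments.
Unset Strict Implicit.
Unset Printing Implicit Defensive.

Import Order.TTheory GRing.Theory Num.Theory ComplexField.Normc.

Local Open Scope classical_set_scope.
Local Open Scope ring_scope.
Local Open Scope complex_scope.

Section SpectralNorm.
Variable R : realType.

Definition l2norm (n : nat) (x : 'cV[R[i]]_n) : R :=
  Num.sqrt (\sum_i (normc (x i 0)) ^+ 2).

Definition opnorm (m n : nat) (M : 'M[R[i]]_(m, n)) : R :=
  sup [set l2norm (M *m x) | x in [set x : 'cV[R[i]]_n | l2norm x <= 1]].

(* Eigenvalues with algebraic multiplicity: the roots of the characteristic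
   polynomial.  For a Hermitian matrix they are real, so taking real parts
   loses nothing. *)
Definition eigenvalues (n : nat) (M : 'M[R[i]]_n) : seq R[i] :=
  sval (closed_field_poly_normal (char_poly M)).

Definition sorted_eigenvalues (n : nat) (M : 'M[R[i]]_n) : seq R :=
  sort <=%R [seq complex.Re z | z <- eigenvalues M].

End SpectralNorm.

Inductive arith_op := Add | Sub | Mul | Div.

Section FloatingPoint.
Variable R : realType.

Definition exact_op (o : arith_op) (a b : R[i]) : R[i] :=
  match o with
  | Add => a + b
  | Sub => a - b
  | Mul => a * b
  | Div => a / b
  end.

(* The relative error is a complex number of modulus at most u; componentwise
   rounding of a complex sum, or of a real-by-complex product, is covered. *)
Record fp_arith (u : R) := FpArith {
  fl : arith_op -> R[i] -> R[i] -> R[i];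
  fl_store : R[i] -> R[i];
  flE : forall o a b, o <> Div \/ b <> 0 ->
    exists2 d : R[i], normc d <= u & fl o a b = (1 + d) * exact_op o a b;
  fl_storeE : forall a,
    exists2 d : R[i], normc d <= u & fl_store a = (1 + d) * a }.

End FloatingPoint.

(* Matrix multiplication algorithms are division-free straight-line programs.
   The registers initially hold the entries of A, then those of B, both in
   row-major order; each instruction appends one register, and the entry (i, j)
   of the product is read in the register slp_out i j at the end. *)
Section MatrixMultiplication.
Variable R : realType.

Inductive operand := Cst of R[i] | Reg of nat.

Definition instr := (arith_op * operand * operand)%type.

Record mm_prog (n : nat) := MMProg {
  slp_code : seq instr;
  slp_out : 'I_n -> 'I_n -> nat }.

Definition slp_val (store : R[i] -> R[i]) (r : seq R[i]) (a : operand) : R[i] :=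
  match a with Cst c => store c | Reg k => nth 0 r k end.

Definition slp_step (ev : arith_op -> R[i] -> R[i] -> R[i])
    (store : R[i] -> R[i]) (r : seq R[i]) (i : instr) : seq R[i] :=
  rcons r (ev i.1.1 (slp_val store r i.1.2) (slp_val store r i.2)).

Definition mx_entries (n : nat) (A : 'M[R[i]]_n) : seq R[i] :=
  [seq A i j | i <- enum 'I_n, j <- enum 'I_n].

Definition mm_run (ev : arith_op -> R[i] -> R[i] -> R[i])
    (store : R[i] -> R[i]) (n : nat) (p : mm_prog n) (A B : 'M[R[i]]_n) :
    'M[R[i]]_n :=
  \matrix_(i, j) nth 0
    (foldl (slp_step ev store) (mx_entries A ++ mx_entries B) (slp_code p))
    (slp_out p i j).

Definition mm_correct (n : nat) (p : mm_prog n) : Prop :=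
  all (fun i : instr => if i.1.1 is Div then false else true) (slp_code p) /\
  forall A B, mm_run (@exact_op R) id p A B = A *m B.

Definition mm_ops (n : nat) (p : mm_prog n) : nat := size (slp_code p).

Definition mm_exponent : R :=
  inf [set t | exists K : R, forall n, (0 < n)%N ->
    exists2 p : mm_prog n, mm_correct p & (mm_ops p)%:R <= K * n%:R `^ t].

(* Normwise stability with a polynomially bounded error constant. *)
Definition mm_stable (MM : forall n, mm_prog n) : Prop :=
  exists K c : R, forall n (u : R) (F : fp_arith u) (A B : 'M[R[i]]_n),
    (0 < n)%N -> 0 < u -> K * n%:R `^ c * u <= 1 ->
    opnorm (mm_run (fl F) (fl_store F) (MM n) A B - A *m B)
      <= K * n%:R `^ c * u * opnorm A * opnorm B.

Definition stable_fast_mm (eta : R) (MM : forall n, mm_prog n) : Prop :=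
  [/\ forall n, mm_correct (MM n),
      mm_stable MM &
      exists K : R, forall n, (0 < n)%N ->
        (mm_ops (MM n))%:R <= K * n%:R `^ (mm_exponent + eta)].

End MatrixMultiplication.

HB.instance Definition _ (R : realType) := isPointed.Build R[i] 0.

Section Probability.
Variable R : realType.

(* The Borel sigma-algebra of complex matrices, generated by the real and
   imaginary parts of the entries. *)
Definition mx_cylinders (m n : nat) : set (set 'M[R[i]]_(m, n)) :=
  [set S | exists i j (B : set R), measurable B /\
    (S = [set X : 'M[R[i]]_(m, n) | B (complex.Re (X i j))] \/
     S = [set X : 'M[R[i]]_(m, n) | B (complex.Im (X i j))])].

Definition mx_space (m n : nat) := g_sigma_algebraType (@mx_cylinders m n).

Definition with_prob_ge (d : measure_display) (T : measurableType d)
    (P : set T -> \bar R) (p : R) (E : set T) : Prop :=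
  exists S : set T, [/\ measurable S, S `<=` E & (p%:E <= P S)%E].

Section Gaussian.
Variables (d : measure_display) (T : measurableType d) (P : probability T R).

Definition mx_part (n : nat) (G : T -> 'M[R[i]]_n)
    (k : 'I_n * 'I_n * bool) (w : T) : R :=
  let z := G w k.1.1 k.1.2 in if k.2 then complex.Re z else complex.Im z.

(* N_C(0, s^2) has independent real and imaginary parts, both of law
   N(0, s^2/2); normal_prob is parameterized by the standard deviation. *)
Definition iid_complex_normal (s : R) (n : nat) (G : T -> 'M[R[i]]_n) : Prop :=
  [/\ forall k, measurable_fun setT (mx_part G k),
      forall k (B : set R), measurable B ->
        P (mx_part G k @^-1` B) = normal_prob 0 (s / Num.sqrt 2) B &
      forall B : 'I_n * 'I_n * bool -> set R, (forall k, measurable (B k)) ->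
        fine (P [set w | forall k, B k (mx_part G k w)])
          = \prod_k fine (P (mx_part G k @^-1` B k))].

(* The entries of Z are n^2 outputs of a cN-stable Gaussian sampler called with
   standard deviation s on a machine of unit roundoff u. *)
Definition stable_samples (cN s u : R) (n : nat) (Z : T -> 'M[R[i]]_n) : Prop :=
  measurable_fun setT (Z : T -> mx_space n n) /\
  exists2 G : T -> 'M[R[i]]_n, iid_complex_normal s G &
    forall w i j, normc (Z w i j - G w i j) <= cN * s * u.

End Gaussian.

End Probability.

(* Values paired with the number of operations spent on computing them. *)
Definition counted (T : Type) : Type := (T * nat)%type.

Definition tick (T : Type) (k : nat) (x : T) : counted T := (x, k).

Definition cbind (T U : Type) (x : counted T) (f : T -> counted U) : counted U :=
  let y := f x.1 in (y.1, (x.2 + y.2)%N).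

Notation "'let*' x := e 'in' f" := (cbind e (fun x => f))
  (at level 200, x name, e at level 200, f at level 200).

Definition mx_seq (T : Type) (m n : nat) (M : 'I_m -> 'I_n -> counted T) :
    counted 'M[T]_(m, n) :=
  (\matrix_(i, j) (M i j).1, \sum_i \sum_j (M i j).2)%N.

Section Algorithms.
Variable R : realType.

(* Z holds the outputs of the Gaussian sampler, each obtained at cost tN. *)
Definition SHATTERH (u : R) (F : fp_arith u) (tN n : nat)
    (A' : 'M[R[i]]_n) (gamma : R) (Z : 'M[R[i]]_n) : counted 'M[R[i]]_n :=
  let* Zt := mx_seq (fun i j => tick tN (Z i j)) in
  let* S := mx_seq (fun i j => tick 1 (fl F Add (Zt i j) (Zt j i)^*)) in
  let* P := mx_seq (fun i j => tick 1 (fl F Mul gamma%:C (S i j))) in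
  mx_seq (fun i j => tick 1 (fl F Add (A' i j) (P i j))).

(* SHATTERH calls the sampler with parameter 1/(2n).  This is either its standard
   deviation s, or (the normalization making Z + Z^* a GUE matrix with entries
   of variance 1/n) its variance s^2; both conventions are covered. *)
Definition sampler_scale (n : nat) (s : R) : Prop :=
  s = (2 * n%:R)^-1 \/ s = Num.sqrt (2 * n%:R)^-1.

(* A randomized eigensolver: besides its input matrix and accuracy it takes the
   outcome in Omega of its internal coin tosses, and it returns V and the
   diagonal of D. *)
Definition eigensolver (Omega : Type) : Type :=
  forall u : R, fp_arith u -> forall n : nat,
    'M[R[i]]_n -> R -> Omega -> counted ('M[R[i]]_n * 'rV[R[i]]_n).

Definition eig_success (n : nat) (M : 'M[R[i]]_n) (delta : R)
    (VD : 'M[R[i]]_n * 'rV[R[i]]_n) : Prop :=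
  let V := VD.1 in
  [/\ V \in unitmx,
      opnorm (M - V *m diag_mx VD.2 *m invmx V) <= delta &
      opnorm V * opnorm (invmx V) <= 32 * n%:R `^ (5 / 2) / delta].

Definition EIG_spec (d : measure_display) (Omega : measurableType d)
    (P : probability Omega R) (TMM : nat -> nat) (EIG : eigensolver Omega) :
    Prop :=
  (forall (u : R) (F : fp_arith u) (n : nat) (delta : R),
    measurable_fun setT
      ((fun p : mx_space R n n * Omega => EIG u F n p.1 delta p.2)
        : _ -> mx_space R n n * mx_space R 1 n * nat)%type) /\
  exists Kbits Kops : R,
    forall (u : R) (F : fp_arith u) (n : nat) (delta : R),
      (0 < n)%N -> 0 < delta < 1 -> 0 < u < 1 ->
      Kbits * ln (n%:R / delta) ^+ 4 * ln n%:R <= ln u^-1 ->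
      (forall M : 'M[R[i]]_n, opnorm M <= 1 ->
        with_prob_ge P (1 - 14 / n%:R)
          [set w | eig_success M delta (EIG u F n M delta w).1]) /\
      (forall (M : 'M[R[i]]_n) (w : Omega),
        ((EIG u F n M delta w).2)%:R
          <= Kops * (TMM n)%:R * ln (n%:R / delta) ^+ 2).

Definition Phi : R := 16.

(* The scalings by Phi and the scalar parameters are not rounded, as in the
   description of the algorithm, but they are counted. *)
Definition EVALSH (u : R) (F : fp_arith u) (tN n : nat)
    (eig : 'M[R[i]]_n -> R -> counted ('M[R[i]]_n * 'rV[R[i]]_n))
    (Z : 'M[R[i]]_n) (A : 'M[R[i]]_n) (eps : R) : counted 'rV[R]_n :=
  let* A' := mx_seq (fun i j => tick 1 (A i j / Phi%:C)) in
  let* eps' := tick 1 (eps / Phi) in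
  let* gamma := tick 1 (eps' / 16) in
  let* X := SHATTERH F tN A' gamma Z in
  let* delta := tick 5 (1 / 4 * (gamma / (2 * n%:R ^+ 3))) in
  let* VD := eig X delta in
  mx_seq (fun (i : 'I_1) j => tick 1 (Phi * complex.Re (VD.2 i j))).

Definition eigenvalues_within (n : nat) (A : 'M[R[i]]_n) (lam : 'rV[R]_n)
    (eps : R) : Prop :=
  forall i, (i < n)%N ->
    `| nth 0 (sorted_eigenvalues A) i
       - nth 0 (sort <=%R [seq lam 0 j | j <- enum 'I_n]) i | <= eps.

End Algorithms.

(* Main.v *)
(* No eigenvalue gap of the shattered matrix is needed.  Let H = A' + gamma W with
   W = G + G^* be the exact Hermitian perturbation and let V D V^-1 = H + E be the
   matrix diagonalized by EIG, with |E| <= 2 delta.  In a Schur basis Q of H + E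
   the matrix Q H Q^* agrees with -Q E Q^* on one side of the diagonal, hence, being
   Hermitian, it is entrywise within 2 delta of diag(Re D_ii); by Weyl the sorted
   real parts of D are within 2 n delta <= 2 gamma of the spectrum of H, which is
   itself within 14 gamma of that of A'.  Since gamma = eps'/16 this is eps'.

   Weyl's inequality is used in the form of counts: the number of eigenvalues of
   A below t is at most the number of eigenvalues of B below t + |A - B|.

   The bound |W| <= 2 |G| <= 14 holds with probability at least 1 - 3/n by a union
   bound over a grid net of cardinality at most 2^(12 n), the Gaussian tail at each
   pair of net points being exp(-2 n (7/2)^2).  The success event of EIG is then
   integrated over the Gaussian sample, and 1 - 17/n <= (1 - 3/n)(1 - 14/n).

   The linear overhead of the algorithm is absorbed by the matrix multiplication
   count because any correct straight-line program has at least n^2 instructions. *)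

Require Import Defs.
From HB Require Import structures.
From mathcomp Require Import all_boot all_order all_algebra.
From mathcomp Require Import complex.
From mathcomp Require Import all_classical all_reals all_analysis.
From mathcomp Require Import measurable_realfun.
From mathcomp Require Import ring lra zify.

Import Order.TTheory GRing.Theory Num.Theory ComplexField.Normc.

Local Open Scope classical_set_scope.
Local Open Scope ring_scope.
Local Open Scope complex_scope.

Set Implicit Arguments.
Unset Strict Implicit.
Unset Printing Implicit Defensive.

(** * Complex modulus and spectral norm *)

Section ComplexModulus.
Variable R : realType.
Implicit Types z w : R[i].

Lemma normc_ge0 z : 0 <= normc z.
Proof. by case: z => a b; exact: sqrtr_ge0. Qed.

Lemma sqr_normcE z : normc z ^+ 2 = complex.Re z ^+ 2 + complex.Im z ^+ 2.
Proof. by case: z => a b /=; rewrite sqr_sqrtr// addr_ge0 ?sqr_ge0. Qed.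

Lemma normc_conj z : normc z^* = normc z.
Proof. by case: z => a b /=; rewrite sqrrN. Qed.

Lemma normc_real_complex (a : R) : normc a%:C = `|a|.
Proof. by rewrite /= expr0n addr0 sqrtr_sqr. Qed.

Lemma ler_normc_Re z : `|complex.Re z| <= normc z.
Proof.
rewrite -(ler_pXn2r (_ : 0 < 2)%N) ?nnegrE ?normc_ge0//.
by rewrite sqr_normcE real_normK ?num_real// lerDl sqr_ge0.
Qed.

Lemma mulc_conj z : z^* * z = (normc z ^+ 2)%:C.
Proof.
by rewrite sqr_normcE; case: z => a b; simpc => /=; congr (_ +i* _); ring.
Qed.

Lemma ReD z w : complex.Re (z + w) = complex.Re z + complex.Re w.
Proof. by case: z w => [? ?] [? ?]. Qed.

Lemma Re_sum (I : Type) (r : seq I) (P : pred I) (F : I -> R[i]) :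
  complex.Re (\sum_(i <- r | P i) F i) = \sum_(i <- r | P i) complex.Re (F i).
Proof. by apply: (big_morph (@complex.Re R)) => //; exact: ReD. Qed.

Lemma normc_sum (I : Type) (r : seq I) (P : pred I) (F : I -> R[i]) :
  normc (\sum_(i <- r | P i) F i) <= \sum_(i <- r | P i) normc (F i).
Proof.
elim/big_rec2: _ => [|i y x _ le_xy]; first by rewrite normc0.
by apply: le_trans (le_normcD _ _) _; rewrite lerD2l.
Qed.

End ComplexModulus.

(** Lagrange's identity: twice the defect of the squared inequality is the double sum of
    [(a i * b j - a j * b i) ^+ 2]. *)
Lemma cauchy_schwarz_sum (R : rcfType) (I : finType) (a b : I -> R) :
  \sum_i a i * b i
    <= Num.sqrt (\sum_i a i ^+ 2) * Num.sqrt (\sum_i b i ^+ 2).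
Proof.
have a0 : 0 <= \sum_i a i ^+ 2 by apply: sumr_ge0 => i _; exact: sqr_ge0.
have b0 : 0 <= \sum_i b i ^+ 2 by apply: sumr_ge0 => i _; exact: sqr_ge0.
rewrite -sqrtrM// (le_trans (ler_norm _))// -sqrtr_sqr ler_wsqrtr//.
rewrite -(ler_pM2l (_ : 0 < 2))// -subr_ge0.
suff -> : 2 * ((\sum_i a i ^+ 2) * \sum_i b i ^+ 2)
    - 2 * (\sum_i a i * b i) ^+ 2 = \sum_i \sum_j (a i * b j - a j * b i) ^+ 2.
  by apply: sumr_ge0 => i _; apply: sumr_ge0 => j _; exact: sqr_ge0.
rewrite [RHS](eq_bigr (fun i => \sum_j a i ^+ 2 * b j ^+ 2
   + \sum_j b i ^+ 2 * a j ^+ 2 - 2 * \sum_j a i * b i * (a j * b j))); last first.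
  move=> i _; rewrite mulr_sumr -big_split -sumrB /=.
  by apply: eq_bigr => j _; ring.
rewrite sumrB big_split /= -mulr_sumr expr2 !big_distrlr /=.
by rewrite [X in _ = _ + X - _]exchange_big /= mulrDl !mul1r; congr (_ + _ - _);
  apply: eq_bigr => i _; apply: eq_bigr => j _; ring.
Qed.

(** * Euclidean norm, operator norm and sesquilinear forms *)

Section SpectralNormTheory.
Variable R : realType.
Local Notation C := R[i].

Lemma l2norm_ge0 n (x : 'cV[C]_n) : 0 <= l2norm x.
Proof. exact: sqrtr_ge0. Qed.

Lemma sqr_l2norm n (x : 'cV[C]_n) : l2norm x ^+ 2 = \sum_i normc (x i 0) ^+ 2.
Proof. by rewrite sqr_sqrtr//; apply: sumr_ge0 => i _; exact: sqr_ge0. Qed.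

Lemma l2norm_le n (x : 'cV[C]_n) (c : R) : 0 <= c ->
  \sum_i normc (x i 0) ^+ 2 <= c ^+ 2 -> l2norm x <= c.
Proof.
by move=> c0 xc; rewrite -(ler_pXn2r (_ : 0 < 2)%N) ?nnegrE ?l2norm_ge0 ?sqr_l2norm.
Qed.

Lemma l2norm0 n : l2norm (0 : 'cV[C]_n) = 0.
Proof. by rewrite /l2norm big1 ?sqrtr0// => i _; rewrite mxE normc0 expr0n. Qed.

Lemma l2norm_eq0 n (x : 'cV[C]_n) : l2norm x = 0 -> x = 0.
Proof.
move=> x0; have /eqP := sqr_l2norm x.
rewrite x0 expr0n eq_sym psumr_eq0; last by move=> i _; exact: sqr_ge0.
move=> /allP x0'; apply/matrixP => i j; rewrite ord1 mxE.
apply: eq0_normc; apply/eqP; rewrite -sqrf_eq0.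
by have := x0' i; rewrite mem_index_enum => /(_ isT).
Qed.

Lemma l2norm_gt0 n (x : 'cV[C]_n) : x != 0 -> 0 < l2norm x.
Proof.
by move=> x0; rewrite lt_def l2norm_ge0 andbT; apply: contra x0 => /eqP/l2norm_eq0 ->.
Qed.

Lemma l2normZ n (c : C) (x : 'cV[C]_n) : l2norm (c *: x) = normc c * l2norm x.
Proof.
apply/eqP; rewrite -(eqrXn2 (_ : 0 < 2)%N) ?mulr_ge0 ?normc_ge0 ?l2norm_ge0//.
rewrite exprMn !sqr_l2norm mulr_sumr; apply/eqP/eq_bigr => i _.
by rewrite mxE normcM exprMn.
Qed.

Lemma l2normD n (x y : 'cV[C]_n) : l2norm (x + y) <= l2norm x + l2norm y.
Proof.
apply: l2norm_le; first by rewrite addr_ge0 ?l2norm_ge0.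
rewrite sqrrD !sqr_l2norm.
apply: (@le_trans _ _ (\sum_i (normc (x i 0) + normc (y i 0)) ^+ 2)).
  apply: ler_sum => i _; rewrite mxE ler_pXn2r ?nnegrE ?addr_ge0 ?normc_ge0//.
  exact: le_normcD.
under eq_bigr do rewrite sqrrD.
rewrite !big_split /= lerD2r lerD2l -mulr2n lerMn2r /=.
exact: cauchy_schwarz_sum.
Qed.

Lemma normc_dot_le n (x y : 'cV[C]_n) :
  normc (\sum_i (y i 0)^* * x i 0) <= l2norm y * l2norm x.
Proof.
apply: le_trans (normc_sum _ _ _) _.
under eq_bigr do rewrite normcM normc_conj.
exact: cauchy_schwarz_sum.
Qed.

Lemma normc_coord_le n (x : 'cV[C]_n) i : normc (x i 0) <= l2norm x.
Proof.
rewrite -(ler_pXn2r (_ : 0 < 2)%N) ?nnegrE ?l2norm_ge0 ?normc_ge0//.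
by rewrite sqr_l2norm (bigD1 i)//= lerDl sumr_ge0// => j _; exact: sqr_ge0.
Qed.

(** Cauchy-Schwarz on each row. This Frobenius bound shows that the supremum defining [opnorm] is
    taken over a bounded set, and it also yields [opnorm_le_entries]. *)
Lemma l2norm_mulmx_frob m n (M : 'M[C]_(m, n)) (x : 'cV[C]_n) :
  l2norm (M *m x)
    <= Num.sqrt (\sum_i \sum_j normc (M i j) ^+ 2) * l2norm x.
Proof.
apply: l2norm_le; first by rewrite mulr_ge0 ?sqrtr_ge0 ?l2norm_ge0.
rewrite exprMn sqr_sqrtr; last first.
  by apply: sumr_ge0 => i _; apply: sumr_ge0 => j _; exact: sqr_ge0.
rewrite mulr_suml; apply: ler_sum => i _.
have s0 : 0 <= \sum_j normc (M i j) ^+ 2.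
  by apply: sumr_ge0 => j _; exact: sqr_ge0.
rewrite -[X in X * _]sqr_sqrtr// -exprMn.
rewrite ler_pXn2r ?nnegrE ?normc_ge0 ?mulr_ge0 ?sqrtr_ge0//.
rewrite mxE; apply: le_trans (normc_sum _ _ _) _.
under eq_bigr do rewrite normcM.
exact: cauchy_schwarz_sum.
Qed.

Lemma opnorm_has_ubound m n (M : 'M[C]_(m, n)) :
  has_ubound [set l2norm (M *m x) | x in [set x : 'cV[C]_n | l2norm x <= 1]].
Proof.
exists (Num.sqrt (\sum_i \sum_j normc (M i j) ^+ 2)) => _ [x /= x1 <-].
apply: le_trans (l2norm_mulmx_frob _ _) _.
by rewrite ler_piMr// sqrtr_ge0.
Qed.

Lemma opnorm_ge0 m n (M : 'M[C]_(m, n)) : 0 <= opnorm M.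
Proof.
apply: (@le_trans _ _ (l2norm (M *m (0 : 'cV_n)))); first exact: l2norm_ge0.
by apply: (ub_le_sup (opnorm_has_ubound M)); exists 0 => //=; rewrite l2norm0.
Qed.

Lemma l2norm_mulmx_le m n (M : 'M[C]_(m, n)) (x : 'cV[C]_n) :
  l2norm (M *m x) <= opnorm M * l2norm x.
Proof.
have [->|x0] := eqVneq x 0; first by rewrite mulmx0 !l2norm0 mulr0.
have nx0 := l2norm_gt0 x0.
rewrite -ler_pdivrMr// mulrC.
have -> : (l2norm x)^-1 * l2norm (M *m x) = l2norm (M *m ((l2norm x)^-1%:C *: x)).
  by rewrite -scalemxAr l2normZ normc_real_complex ger0_norm ?invr_ge0 ?l2norm_ge0.
apply: (ub_le_sup (opnorm_has_ubound M)); eexists; last reflexivity.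
rewrite /= l2normZ normc_real_complex ger0_norm ?invr_ge0 ?l2norm_ge0//.
by rewrite mulVf// gt_eqF.
Qed.

Lemma opnorm_le m n (M : 'M[C]_(m, n)) (c : R) : 0 <= c ->
  (forall x, l2norm (M *m x) <= c * l2norm x) -> opnorm M <= c.
Proof.
move=> c0 Mc; apply: ge_sup.
  by exists (l2norm (M *m 0)); exists 0 => //=; rewrite l2norm0.
move=> _ [x /= x1 <-]; apply: le_trans (Mc x) _.
by rewrite ler_piMr.
Qed.

Lemma opnormD m n (M N : 'M[C]_(m, n)) : opnorm (M + N) <= opnorm M + opnorm N.
Proof.
apply: opnorm_le; first by rewrite addr_ge0 ?opnorm_ge0.
move=> x; rewrite mulmxDl mulrDl; apply: le_trans (l2normD _ _) _.
by apply: lerD; exact: l2norm_mulmx_le.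
Qed.

Lemma opnormZ_le m n (c : C) (M : 'M[C]_(m, n)) :
  opnorm (c *: M) <= normc c * opnorm M.
Proof.
apply: opnorm_le; first by rewrite mulr_ge0 ?opnorm_ge0 ?normc_ge0.
move=> x; rewrite -scalemxAl l2normZ -mulrA.
by apply: ler_wpM2l; [exact: normc_ge0|exact: l2norm_mulmx_le].
Qed.

Lemma opnormN m n (M : 'M[C]_(m, n)) : opnorm (- M) = opnorm M.
Proof.
suff le N : opnorm (- N : 'M[C]_(m, n)) <= opnorm N.
  apply/eqP; rewrite eq_le le /=.
  by have := le (- M); rewrite opprK.
rewrite -scaleN1r; apply: le_trans (opnormZ_le _ _) _.
by rewrite normcN normc1 mul1r.
Qed.

Lemma opnorm_le_entries n (M : 'M[C]_n) (c : R) : 0 <= c ->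
  (forall i j, normc (M i j) <= c) -> opnorm M <= n%:R * c.
Proof.
move=> c0 Mc; apply: opnorm_le; first by rewrite mulr_ge0.
move=> x; apply: le_trans (l2norm_mulmx_frob _ _) _.
apply: ler_wpM2r; first exact: l2norm_ge0.
rewrite -[leRHS]ger0_norm ?mulr_ge0// -sqrtr_sqr ler_wsqrtr//.
apply: (@le_trans _ _ (\sum_(i < n) \sum_(j < n) c ^+ 2)).
  apply: ler_sum => i _; apply: ler_sum => j _.
  by rewrite ler_pXn2r ?nnegrE ?normc_ge0.
by rewrite !sumr_const !card_ord -mulrnA -(mulr_natl (c ^+ 2)) natrM exprMn expr2.
Qed.

Lemma normc_entry_le m n (M : 'M[C]_(m, n)) i j : normc (M i j) <= opnorm M.
Proof.
have -> : M i j = (M *m delta_mx j (0 : 'I_1)) i 0 by rewrite -colE mxE.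
apply: le_trans (normc_coord_le _ _) _.
apply: le_trans (l2norm_mulmx_le _ _) _.
rewrite ler_piMr ?opnorm_ge0// l2norm_le// expr1n (bigD1 j)//= big1.
  by rewrite mxE !eqxx normc1 expr1n addr0.
by move=> k kj; rewrite mxE (negPf kj) normc0 expr0n.
Qed.

Lemma normc_form_le n (M : 'M[C]_n) (x y : 'cV[C]_n) :
  normc (\sum_i (y i 0)^* * (M *m x) i 0) <= opnorm M * (l2norm y * l2norm x).
Proof.
apply: le_trans (normc_dot_le _ _) _.
rewrite mulrCA ler_wpM2l ?l2norm_ge0//.
exact: l2norm_mulmx_le.
Qed.

Lemma dot_selfE n (x : 'cV[C]_n) :
  \sum_i (x i 0)^* * x i 0 = (l2norm x ^+ 2)%:C.
Proof.
by rewrite sqr_l2norm rmorph_sum /=; apply: eq_bigr => i _; rewrite mulc_conj.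
Qed.

End SpectralNormTheory.

(** * Perturbation of sorted spectra *)

Section SortedCounts.
Variable R : realType.
Implicit Types s : seq R.

(** Turns statements on sorted spectra into counts. One way, the first [i.+1] sorted items all lie
    below the item of index [i]; the other way, no item from index [i] on is counted. *)
Lemma nth_sort_le s (i : nat) (t : R) : (i < size s)%N ->
  (nth 0 (sort <=%R s) i <= t) = (i < count (fun x => (x <= t)%R) s)%N.
Proof.
move=> lt_is; have := permEl (perm_sort <=%R s).
set u := sort _ s => /permP <-.
have u_sorted : sorted <=%R u by apply: sort_sorted; exact: le_total.
have szu : size u = size s by rewrite size_sort.
have mono := sorted_leq_nth le_trans lexx 0 u_sorted.
apply/idP/idP => [le_ut|].
  rewrite -(cat_take_drop i.+1 u) count_cat.
  suff /eqP -> : count (fun x => x <= t) (take i.+1 u) == i.+1 by rewrite ltnS leq_addr.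
  have szt : size (take i.+1 u) = i.+1 by rewrite size_takel// szu.
  rewrite -{2}szt -all_count; apply/(all_nthP 0) => j; rewrite szt => lt_ji.
  rewrite nth_take//; apply: le_trans le_ut.
  by apply: mono => //; rewrite inE szu// (leq_ltn_trans _ lt_is).
apply: contraLR; rewrite -ltNge -leqNgt => lt_tu.
rewrite -(cat_take_drop i u) count_cat.
have -> : count (fun x => x <= t) (drop i u) = 0%N.
  apply/eqP; rewrite -leqn0 leqNgt -has_count; apply/hasPn => x /(nthP 0)[j].
  rewrite size_drop nth_drop => lt_j <-; rewrite -ltNge; apply: lt_le_trans lt_tu _.
  have lt_ij : (i + j < size s)%N by rewrite -szu -ltn_subRL.
  by apply: mono; rewrite ?inE ?szu ?leq_addr.
by rewrite addn0 (leq_trans (count_size _ _))// size_takel// szu ltnW.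
Qed.

(** Comparison of counting functions: for lists of equal length it bounds each order statistic of
    [s2] by that of [s1] plus [e]. In this form it ignores the order of the lists and composes by
    adding the shifts. *)
Definition count_dominated (e : R) s1 s2 : Prop := forall t,
  (count (fun x => (x <= t)%R) s1 <= count (fun x => (x <= t + e)%R) s2)%N.

Lemma count_dominated_perm e s1 s2 s1' s2' : perm_eq s1 s1' -> perm_eq s2 s2' ->
  count_dominated e s1 s2 -> count_dominated e s1' s2'.
Proof. by move=> /permP p1 /permP p2 d t; rewrite -p1 -p2. Qed.

Lemma count_dominated_trans e e' s1 s2 s3 :
  count_dominated e s1 s2 -> count_dominated e' s2 s3 ->
  count_dominated (e + e') s1 s3.
Proof.
by move=> d12 d23 t; apply: leq_trans (d12 t) _; rewrite addrA; exact: d23.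
Qed.

Lemma count_dominatedW e e' s1 s2 : e <= e' ->
  count_dominated e s1 s2 -> count_dominated e' s1 s2.
Proof.
move=> ee' d t; apply: leq_trans (d t) _; apply: sub_count => x /= /le_trans; apply.
by rewrite lerD2l.
Qed.

Lemma count_dominated_scale (c e : R) s1 s2 : 0 < c ->
  count_dominated e s1 s2 ->
  count_dominated (c * e) [seq c * x | x <- s1] [seq c * x | x <- s2].
Proof.
move=> c0 d t; rewrite !count_map; have := d (t / c).
have E1 : (fun x => x <= t / c) =1 preim ( *%R c) (fun x => x <= t).
  by move=> x /=; rewrite ler_pdivlMr// mulrC.
have E2 : (fun x => x <= t / c + e) =1 preim ( *%R c) (fun x => x <= t + c * e).
  move=> x /=; rewrite -(ler_pM2l c0) mulrDr [c * (t / c)]mulrC divfK//.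
  by rewrite gt_eqF.
by rewrite (eq_count E1) (eq_count E2).
Qed.

Lemma count_dominated_nth e s1 s2 (i : nat) :
  size s1 = size s2 -> (i < size s1)%N -> count_dominated e s1 s2 ->
  nth 0 (sort <=%R s2) i <= nth 0 (sort <=%R s1) i + e.
Proof.
move=> szs lt_i d; rewrite nth_sort_le -?szs//.
apply: leq_trans (d _); rewrite -nth_sort_le//.
Qed.

Lemma count_dominated_dist e s1 s2 (i : nat) :
  size s1 = size s2 -> (i < size s1)%N ->
  count_dominated e s1 s2 -> count_dominated e s2 s1 ->
  `|nth 0 (sort <=%R s1) i - nth 0 (sort <=%R s2) i| <= e.
Proof.
move=> szs lt_i d12 d21; rewrite ler_distlC.
rewrite (count_dominated_nth _ _ d12)// andbT lerBlDr.
by apply: count_dominated_nth; rewrite -?szs.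
Qed.

End SortedCounts.

(** * Spectra under unitary conjugation and perturbation *)

Section Eigenvalues.
Local Open Scope sesquilinear_scope.
Variable R : realType.
Local Notation C := R[i].

Lemma char_poly_conj n (V T : 'M[C]_n) : V \in unitmx ->
  char_poly (V *m T *m invmx V) = char_poly T.
Proof.
move=> Vu; rewrite /char_poly.
have VV : map_mx polyC V *m map_mx polyC (invmx V) = 1%:M.
  by rewrite -map_mxM mulmxV// map_mx1.
have -> : char_poly_mx (V *m T *m invmx V) =
    map_mx polyC V *m char_poly_mx T *m map_mx polyC (invmx V).
  rewrite /char_poly_mx mulmxBr mulmxBl !map_mxM scalar_mxC -[X in _ = X - _]mulmxA VV.
  by rewrite mulmx1.
by rewrite !det_mulmx mulrAC -det_mulmx VV det1 mul1r.
Qed.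

(** The roots are listed in no specified order, so only a permutation can be claimed; it follows
    from unique factorization into linear factors. *)
Lemma eigenvalues_trig n (V T : 'M[C]_n) : V \in unitmx -> is_trig_mx T ->
  perm_eq (eigenvalues (V *m T *m invmx V)) [seq T i i | i <- enum 'I_n].
Proof.
move=> Vu Tt; rewrite /eigenvalues; case: closed_field_poly_normal => s /=.
rewrite (monicP (char_poly_monic _)) scale1r char_poly_conj// char_poly_trig//.
by move=> sE; apply: prod_XsubC_eq; rewrite -sE big_map big_enum.
Qed.

Lemma size_eigenvalues n (M : 'M[C]_n) : size (eigenvalues M) = n.
Proof.
rewrite /eigenvalues; case: closed_field_poly_normal => s /=.
rewrite (monicP (char_poly_monic _)) scale1r => /(congr1 (fun p => size (polyseq p))).
by rewrite size_char_poly size_prod_XsubC => -[].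
Qed.

Definition Re_eigenvalues n (M : 'M[C]_n) : seq R :=
  [seq complex.Re z | z <- eigenvalues M].

Definition real_diag n (a : 'I_n -> R) : 'M[C]_n := diag_mx (\row_i (a i)%:C).

Lemma hermsymmxP n (H : 'M[C]_n) : H \is hermsymmx <-> H^t* = H.
Proof.
by split=> [/is_hermitianmxP|HH]; last apply/is_hermitianmxP; rewrite expr0 scale1r.
Qed.

Lemma Re_eigenvalues_trig n (P T : 'M[C]_n) : P \is unitarymx -> is_trig_mx T ->
  perm_eq (Re_eigenvalues (P^t* *m T *m P)) [seq complex.Re (T i i) | i <- enum 'I_n].
Proof.
move=> Pu Tt; have Pu' : P^t* \is unitarymx by rewrite trmxC_unitary.
have -> : [seq complex.Re (T i i) | i <- enum 'I_n] =
    [seq complex.Re z | z <- [seq T i i | i <- enum 'I_n]] by rewrite -map_comp.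
rewrite /Re_eigenvalues; apply: perm_map.
rewrite -{2}(trmxCK P) -(invmx_unitary Pu').
by apply: eigenvalues_trig => //; exact: unitarymx_unit.
Qed.

Lemma hermitian_diagonalization n (H : 'M[C]_n) : H \is hermsymmx ->
  exists (P : 'M[C]_n) (a : 'I_n -> R), [/\ P \is unitarymx,
    H = P^t* *m real_diag a *m P &
    perm_eq (Re_eigenvalues H) [seq a i | i <- enum 'I_n]].
Proof.
move=> Hh; have HE := orthomx_spectralP (hermitian_normalmx Hh).
have /mxOverP dreal := hermitian_spectral_diag_real Hh.
set P := spectralmx H in HE; set d := spectral_diag H in HE dreal.
have Pu : P \is unitarymx by exact: spectral_unitarymx.
have dE : diag_mx d = real_diag (fun i => complex.Re (d 0 i)).
  by congr diag_mx; apply/rowP => i; rewrite mxE RRe_real.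
exists P, (fun i => complex.Re (d 0 i)); split=> //.
  by rewrite -dE -invmx_unitary.
rewrite {1}HE (invmx_unitary Pu).
have -> : [seq complex.Re (d 0 i) | i <- enum 'I_n] =
    [seq complex.Re (diag_mx d i i) | i <- enum 'I_n].
  by apply: eq_map => i; rewrite mxE eqxx mulr1n.
by apply: Re_eigenvalues_trig => //; exact: diag_mx_is_trig.
Qed.

Lemma dotmxcE n (x y : 'cV[C]_n) : \sum_i (x i 0)^* * y i 0 = (x^t* *m y) 0 0.
Proof. by rewrite mxE; apply: eq_bigr => i _; rewrite !mxE. Qed.

Lemma l2norm_unitary n (P : 'M[C]_n) (x : 'cV[C]_n) : P \is unitarymx ->
  l2norm (P *m x) = l2norm x.
Proof.
move=> Pu; apply/eqP; rewrite -(eqrXn2 (_ : 0 < 2)%N) ?l2norm_ge0//.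
apply/eqP/complexI; rewrite -!dot_selfE !dotmxcE trmx_mul map_mxM.
rewrite mulmxA -[X in X *m x]mulmxA -(invmx_unitary Pu).
by rewrite mulVmx ?mulmx1// unitarymx_unit.
Qed.

Lemma opnorm_conj_unitary n (P M : 'M[C]_n) : P \is unitarymx ->
  opnorm (P *m M *m P^t* ) <= opnorm M.
Proof.
move=> Pu; apply: opnorm_le; first exact: opnorm_ge0.
move=> x; rewrite -!mulmxA l2norm_unitary//.
apply: le_trans (l2norm_mulmx_le _ _) _.
have Pu' : P^t* \is unitarymx by rewrite trmxC_unitary.
by rewrite (l2norm_unitary _ Pu').
Qed.

Lemma form_unitary_diag n (P : 'M[C]_n) (a : 'I_n -> R) (x : 'cV[C]_n) :
  complex.Re (\sum_i (x i 0)^* * (P^t* *m real_diag a *m P *m x) i 0) =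
  \sum_k a k * normc ((P *m x) k 0) ^+ 2.
Proof.
rewrite dotmxcE.
have -> : x^t* *m (P^t* *m real_diag a *m P *m x) =
    (P *m x)^t* *m (real_diag a *m (P *m x)) by rewrite trmx_mul map_mxM !mulmxA.
rewrite -dotmxcE Re_sum; apply: eq_bigr => k _.
move: (P *m x) => y; rewrite mul_diag_mx !mxE mulrCA mulc_conj -rmorphM.
by [].
Qed.

Lemma exists_kernel_vector m n (K : 'M[C]_(m, n)) : (m < n)%N ->
  exists2 x : 'cV[C]_n, x != 0 & K *m x = 0.
Proof.
move=> lt_mn; have : kermx K^T != 0.
  rewrite -mxrank_eq0 mxrank_ker -lt0n subn_gt0 mxrank_tr.
  exact: leq_ltn_trans (rank_leq_row _) lt_mn.
move=> /rowV0Pn[v /sub_kermxP vK v0]; exists v^T; first by rewrite trmx_eq0.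
by apply: trmx_inj; rewrite trmx_mul trmxK vK trmx0.
Qed.

(* If more [a i] than [b i] lie below the two thresholds, some nonzero [x] is
   orthogonal to the eigenvectors with [a i > t] and to those with
   [b i <= t + e], and the two quadratic forms are too far apart at [x]. *)
Lemma unitary_diag_card_le n (P Q : 'M[C]_n) (a b : 'I_n -> R) (e t : R) :
  P \is unitarymx -> Q \is unitarymx ->
  opnorm (P^t* *m real_diag a *m P - Q^t* *m real_diag b *m Q) <= e ->
  (#|[pred i | (a i <= t)%R]| <= #|[pred i | (b i <= t + e)%R]|)%N.
Proof.
move=> Pu Qu; set A := (X in opnorm (X - _)); set B := (X in opnorm (_ - X)) => ABe.
rewrite leqNgt; apply/negP => ltba.
pose S := [pred i | t < a i]; pose J := [pred i | b i <= t + e].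
(* [K] has fewer than [n] rows: [#|S|] is [n] minus the number of [a i <= t], and [#|J|] is assumed
   smaller than that number. *)
pose K := col_mx (\matrix_(i < #|S|) row (enum_val i) P)
                 (\matrix_(i < #|J|) row (enum_val i) Q).
have cardS : (#|[pred i | (a i <= t)%R]| + #|S| = n)%N.
  rewrite -[RHS]card_ord -(cardC [pred i | (a i <= t)%R]); congr (_ + _)%N.
  by apply: eq_card => i; rewrite !inE ltNge.
have [|x x0 Kx] := @exists_kernel_vector _ _ K.
  by rewrite /J; lia.
have [PS QJ] : (forall i, i \in S -> (P *m x) i 0 = 0) /\
               (forall i, i \in J -> (Q *m x) i 0 = 0).
  have /eqP := Kx; rewrite mul_col_mx col_mx_eq0 => /andP[/eqP KP /eqP KQ].
  split=> i iS; [move: KP|move: KQ];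
    move=> /matrixP/(_ (enum_rank_in iS i) 0); rewrite [RHS]mxE => K0;
    rewrite -[RHS]K0 !mxE; by apply: eq_bigr => j _; rewrite !mxE enum_rankK_in.
have l2P := sqr_l2norm (P *m x); have l2Q := sqr_l2norm (Q *m x).
rewrite l2norm_unitary// in l2P; rewrite l2norm_unitary// in l2Q.
have qA : complex.Re (\sum_i (x i 0)^* * (A *m x) i 0) <= t * l2norm x ^+ 2.
  rewrite form_unitary_diag l2P mulr_sumr; apply: ler_sum => k _.
  have [kS|] := boolP (k \in S); first by rewrite PS// normc0 expr0n !mulr0.
  by rewrite inE -leNgt => ak; apply: ler_wpM2r ak; exact: sqr_ge0.
(* Strict, since equality would also annihilate the coordinates of [Q *m x] outside [J] and force
   [x = 0]. *)
have qB : (t + e) * l2norm x ^+ 2 < complex.Re (\sum_i (x i 0)^* * (B *m x) i 0).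
  rewrite form_unitary_diag l2Q mulr_sumr -subr_gt0 -sumrB.
  have le0 k : 0 <= b k * normc ((Q *m x) k 0) ^+ 2 -
                      (t + e) * normc ((Q *m x) k 0) ^+ 2.
    have [kJ|] := boolP (k \in J); first by rewrite QJ// normc0 expr0n !mulr0 subrr.
    by rewrite inE -ltNge -mulrBl => /ltW bk; rewrite mulr_ge0 ?sqr_ge0 ?subr_ge0.
  rewrite lt_def sumr_ge0 ?andbT//; apply: contra x0.
  rewrite psumr_eq0// => /allP all0; apply/eqP/l2norm_eq0.
  rewrite -(l2norm_unitary x Qu) [Q *m x](_ : _ = 0) ?l2norm0//.
  apply/matrixP => k j; rewrite ord1 [RHS]mxE.
  have [kJ|] := boolP (k \in J); first exact: QJ.
  rewrite inE -ltNge => bk; apply: eq0_normc; apply/eqP; rewrite -sqrf_eq0.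
  have := all0 k; rewrite mem_index_enum => /(_ isT) /=.
  by rewrite -mulrBl mulf_eq0 subr_eq0 (gt_eqF bk).
have := normc_form_le (A - B) x x; rewrite leNgt => /negP; apply.
apply: le_lt_trans (_ : e * (l2norm x * l2norm x) < _).
  by apply: ler_wpM2r ABe; rewrite mulr_ge0 ?l2norm_ge0.
apply: lt_le_trans (ler_normc_Re _); rewrite -normrN; apply: lt_le_trans (ler_norm _).
rewrite -expr2.
have -> : \sum_i (x i 0)^* * ((A - B) *m x) i 0 =
   \sum_i (x i 0)^* * (A *m x) i 0 - \sum_i (x i 0)^* * (B *m x) i 0.
  by rewrite -sumrB; apply: eq_bigr => i _; rewrite mulmxBl !mxE mulrBr.
have ReN (z : C) : complex.Re (- z) = - complex.Re z by case: z.
rewrite ReD ReN; move: qA qB.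
by move: (complex.Re _) (complex.Re _) (l2norm x ^+ 2) => p q r; clear; lra.
Qed.

Lemma count_enumE n (a : 'I_n -> R) (t : R) :
  count (fun x => x <= t) [seq a i | i <- enum 'I_n] = #|[pred i | a i <= t]|.
Proof.
rewrite count_map cardE -size_filter /enum_mem -filter_predI; congr (size _).
by apply: eq_filter => i; rewrite !inE andbT.
Qed.

Lemma unitary_diag_dominated n (P Q : 'M[C]_n) (a b : 'I_n -> R) (e : R) :
  P \is unitarymx -> Q \is unitarymx ->
  opnorm (P^t* *m real_diag a *m P - Q^t* *m real_diag b *m Q) <= e ->
  count_dominated e [seq a i | i <- enum 'I_n] [seq b i | i <- enum 'I_n].
Proof.
by move=> Pu Qu PQe t; rewrite !count_enumE; exact: unitary_diag_card_le PQe.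
Qed.

Lemma weyl_count n (A B : 'M[C]_n) (e : R) :
  A \is hermsymmx -> B \is hermsymmx -> opnorm (A - B) <= e ->
  count_dominated e (Re_eigenvalues A) (Re_eigenvalues B).
Proof.
move=> /hermitian_diagonalization[P [a [Pu -> pa]]].
move=> /hermitian_diagonalization[Q [b [Qu -> pb]]] AB.
apply: (count_dominated_perm _ _ (unitary_diag_dominated Pu Qu AB));
  by rewrite perm_sym.
Qed.

Lemma hermsymmx_conj_unitary n (P H : 'M[C]_n) : H \is hermsymmx ->
  P *m H *m P^t* \is hermsymmx.
Proof.
move=> /hermsymmxP HH; apply/hermsymmxP.
by rewrite !trmx_mul !map_mxM trmxCK HH mulmxA.
Qed.

(* In a Schur basis of [M] the matrix [M] is triangular, so the entries of [H]
   on one side of the diagonal are those of [H - M]; by symmetry [H] is then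
   entrywise close to the diagonal matrix of the [Re (T i i)]. *)
Lemma nonhermitian_perturbation n (H M : 'M[C]_n) (e : R) : (0 < n)%N ->
  H \is hermsymmx -> opnorm (M - H) <= e ->
  count_dominated (n%:R * e) (Re_eigenvalues H) (Re_eigenvalues M) /\
  count_dominated (n%:R * e) (Re_eigenvalues M) (Re_eigenvalues H).
Proof.
move=> n0 Hh MHe; have [Q Qu MQ] := Schur M n0.
have : is_trig_mx (Q *m M *m Q^t* ) by rewrite -(conjymx M Qu).
set T := Q *m M *m Q^t* => Tt.
have QQ : Q^t* *m Q = 1%:M by rewrite -(invmx_unitary Qu) mulVmx// unitarymx_unit.
have ME : M = Q^t* *m T *m Q.
  by rewrite /T !mulmxA QQ mul1mx -mulmxA QQ mulmx1.
have [P [a [Pu HE pH]]] := hermitian_diagonalization Hh.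
have pM := Re_eigenvalues_trig Qu Tt; rewrite -ME in pM.
set K := Q *m H *m Q^t*; set D := real_diag (fun i => complex.Re (T i i)).
have HKE : H = Q^t* *m K *m Q.
  by rewrite /K !mulmxA QQ mul1mx -mulmxA QQ mulmx1.
have /hermsymmxP Kh : K \is hermsymmx by exact: hermsymmx_conj_unitary.
have TKe i j : normc (T i j - K i j) <= e.
  apply: le_trans MHe; apply: le_trans (opnorm_conj_unitary _ Qu).
  rewrite mulmxBr mulmxBl -/T -/K.
  have -> : T i j - K i j = (T - K) i j by rewrite !mxE.
  exact: normc_entry_le.
clearbody K T.
(* [T] vanishes above the diagonal, so there [K] is [K - T]. On the diagonal [K] is real, and its
   distance to [Re (T i i)] is at most the modulus of [T i i - K i i]. *)
have KDe i j : normc ((K - D) i j) <= e.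
  have lt_ij (k l : 'I_n) : (k < l)%N -> normc (K k l) <= e.
    move=> kl; rewrite -normcN -[- _]add0r -((is_trig_mxP Tt) k l kl).
    exact: TKe.
  have -> : (K - D) i j = K i j - D i j by rewrite !mxE.
  case: (ltngtP i j) => [ij|ji|/val_inj <-].
  - have /negbTE ij' : i != j by rewrite neq_ltn ij.
    by rewrite /D [real_diag _ _ _]mxE ij' mulr0n subr0 lt_ij.
  - have /negbTE ij' : i != j by rewrite neq_ltn ji orbT.
    rewrite /D [real_diag _ _ _]mxE ij' mulr0n subr0.
    by rewrite -Kh 2!mxE normc_conj lt_ij.
  have /(congr1 (@complex.Im R)) ImK : (K i i)^* = K i i.
    by rewrite -{2}Kh 2!mxE.
  have ImK0 : complex.Im (K i i) = 0.
    by move: ImK; case: (K i i) => x y /= => yy; lra.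
  apply: le_trans (TKe i i).
  apply: le_trans (ler_normc_Re _).
  rewrite /D [real_diag _ _ _]mxE eqxx mulr1n mxE; move: ImK0; case: (K i i) => x y /= ->.
  case: (T i i) => x' y' /=.
  by rewrite oppr0 addr0 expr0n addr0 sqrtr_sqr distrC.
have e0 : 0 <= e by apply: le_trans MHe; exact: opnorm_ge0.
have KDn : opnorm (K - D) <= n%:R * e by exact: opnorm_le_entries.
have HDe : opnorm (P^t* *m real_diag a *m P - Q^t* *m D *m Q) <= n%:R * e.
  rewrite -HE HKE -mulmxBl -mulmxBr; apply: le_trans KDn.
  rewrite -[X in opnorm (_ *m X)](trmxCK Q).
  by apply: opnorm_conj_unitary; rewrite trmxC_unitary.
split.
  apply: (count_dominated_perm _ _ (unitary_diag_dominated Pu Qu HDe));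
    by rewrite perm_sym.
rewrite -opnormN opprB in HDe.
apply: (count_dominated_perm _ _ (unitary_diag_dominated Qu Pu HDe));
  by rewrite perm_sym.
Qed.

End Eigenvalues.

(** * A grid net for the spectral norm *)

Section GridNet.
Local Open Scope sesquilinear_scope.
Variable R : realType.
Local Notation C := R[i].

(** The form is tested at the normalized [x] and the normalized [M *m x], where its value is
    [l2norm (M *m x) / l2norm x]. *)
Lemma opnorm_le_form n (M : 'M[C]_n) (c : R) : 0 <= c ->
  (forall x y, l2norm x <= 1 -> l2norm y <= 1 ->
    complex.Re (\sum_i (y i 0)^* * (M *m x) i 0) <= c) ->
  opnorm M <= c.
Proof.
move=> c0 Mc; apply: opnorm_le => // x.
have [->|x0] := eqVneq x 0; first by rewrite mulmx0 !l2norm0 mulr0.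
have [->|Mx0] := eqVneq (M *m x) 0.
  by rewrite l2norm0 mulr_ge0 ?l2norm_ge0.
have nx0 := l2norm_gt0 x0; have nMx0 := l2norm_gt0 Mx0.
have unitZ m (z : 'cV[C]_m) : 0 < l2norm z -> l2norm ((l2norm z)^-1%:C *: z) <= 1.
  by move=> z0; rewrite l2normZ normc_real_complex gtr0_norm ?invr_gt0// mulVf// gt_eqF.
have := Mc _ _ (unitZ _ _ nx0) (unitZ _ _ nMx0).
rewrite -ler_pdivrMr//; apply: le_trans.
rewrite (_ : \sum_i _ = (l2norm (M *m x) / l2norm x)%:C) //.
rewrite -scalemxAr.
have dotZ (a b : R) (z : 'cV[C]_n) :
    \sum_i ((a%:C *: z) i 0)^* * (b%:C *: z) i 0 = (a * b * l2norm z ^+ 2)%:C.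
  rewrite rmorphM /= -dot_selfE mulr_sumr; apply: eq_bigr => i _.
  by rewrite !mxE; case: (z i 0) => p q; simpc; congr (_ +i* _); ring.
rewrite dotZ; congr (_%:C).
by rewrite expr2; field; rewrite !gt_eqF.
Qed.

(** The form of the adjoint at a pair of vectors is the conjugate of the form of [M] at the swapped
    pair, so the moduli agree. *)
Lemma opnorm_adjoint n (M : 'M[C]_n) : opnorm (M^t* ) <= opnorm M.
Proof.
apply: opnorm_le_form; first exact: opnorm_ge0.
move=> x y x1 y1; apply: le_trans (ler_norm _) _; apply: le_trans (ler_normc_Re _) _.
rewrite dotmxcE -normc_conj.
have -> : ((y^t* *m (M^t* *m x)) 0 0)^* = (x^t* *m (M *m y)) 0 0.
  have <- : (y^t* *m (M^t* *m x))^t* = x^t* *m (M *m y).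
    by rewrite !trmx_mul !map_mxM !trmxCK mulmxA.
  by rewrite [RHS]mxE [in RHS]mxE.
rewrite -dotmxcE; apply: le_trans (normc_form_le _ _ _) _.
by rewrite ler_piMr ?opnorm_ge0// mulr_ile1 ?l2norm_ge0.
Qed.

Variable n : nat.
Hypothesis n_gt0 : (0 < n)%N.

(** Rounding [2 n] real coordinates with error at most [mesh] moves a point by at most
    [sqrt (2 n / (32 n))], which is 1/4. *)
Definition mesh : R := (Num.sqrt (32 * n)%:R)^-1.

(** Each real coordinate is coded by a sign and a multiple of [mesh]. Indices up to [32 * n] suffice
    for the unit ball, since 1 is [sqrt (32 n)] meshes. *)
Definition grid : finType := {ffun 'I_n * bool -> bool * 'I_(32 * n).+1}.

Definition grid_coord (p : bool * 'I_(32 * n).+1) : R :=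
  (-1) ^+ p.1 * (mesh * p.2%:R).

Definition grid_point (f : grid) : 'cV[C]_n :=
  \col_i (grid_coord (f (i, true)) +i* grid_coord (f (i, false))).

Definition in_net (f : grid) : bool := l2norm (grid_point f) <= 1.

(** Truncation is towards zero: moduli never grow, so a point of the unit ball is rounded to a point
    of the ball. *)
Definition round_coord (r : R) : bool * 'I_(32 * n).+1 :=
  (r < 0, inord (Num.truncn (`|r| / mesh))).

Definition round_point (x : 'cV[C]_n) : grid :=
  [ffun k => round_coord (if k.2 then complex.Re (x k.1 0) else complex.Im (x k.1 0))].

Lemma mesh_gt0 : 0 < mesh.
Proof. by rewrite invr_gt0 sqrtr_gt0 ltr0n; lia. Qed.

Lemma mesh_sqr : mesh ^+ 2 = (32 * n)%:R^-1.
Proof. by rewrite exprVn sqr_sqrtr. Qed.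

Lemma round_coordP (r : R) : `|r| <= 1 ->
  `|grid_coord (round_coord r)| <= `|r| /\
  `|r - grid_coord (round_coord r)| <= mesh.
Proof.
move=> r1; have m0 := mesh_gt0.
have rm0 : 0 <= `|r| / mesh by rewrite divr_ge0// ltW.
have /andP[tl tu] := truncn_itv rm0.
have tK : (Num.truncn (`|r| / mesh) < (32 * n).+1)%N.
  rewrite ltnS -(ler_nat R); apply: le_trans tl _.
  rewrite ler_pdivrMr//; apply: le_trans r1 _.
  rewrite /mesh ler_pdivlMr ?mul1r ?sqrtr_gt0 ?ltr0n; last by lia.
  rewrite -[leRHS]ger0_norm// -sqrtr_sqr ler_wsqrtr// expr2 -natrM ler_nat.
  by rewrite leq_pmulr//; lia.
rewrite /grid_coord /round_coord /= inordK//.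
set k := Num.truncn _ in tl tu tK *.
have kl : mesh * k%:R <= `|r| by rewrite mulrC -ler_pdivlMr.
have ku : `|r| <= mesh * k%:R + mesh.
  by rewrite -[X in _ + X]mulr1 -mulrDr natr1 mulrC -ler_pdivrMr// ltW.
have mk0 : 0 <= mesh * k%:R by rewrite mulr_ge0// ltW.
split; first by rewrite normrM normrX normrN1 expr1n mul1r ger0_norm.
move: kl ku mk0; move: (mesh * _) => v.
case: ltP => r0 /= kl ku mk0; rewrite ?expr1 ?expr0 ?mulN1r ?mul1r.
  by rewrite ltr0_norm// in kl ku; rewrite ler_norml; lra.
by rewrite ger0_norm// in kl ku; rewrite ler_norml; lra.
Qed.

Lemma round_pointP (x : 'cV[C]_n) : l2norm x <= 1 ->
  in_net (round_point x) /\ l2norm (x - grid_point (round_point x)) <= 4^-1.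
Proof.
move=> x1.
have coord1 i : `|complex.Re (x i 0)| <= 1 /\ `|complex.Im (x i 0)| <= 1.
  have xi1 : normc (x i 0) <= 1 by apply: le_trans (normc_coord_le _ _) x1.
  split; first by apply: le_trans (ler_normc_Re _) xi1.
  have -> : complex.Im (x i 0) = - complex.Re ('i * x i 0).
    by case: (x i 0) => a b; simpc.
  rewrite normrN; apply: le_trans (ler_normc_Re _) _.
  by rewrite normcM /= expr0n expr1n add0r sqrtr1 mul1r.
have sqr_le (a b : R) : `|a| <= b -> a ^+ 2 <= b ^+ 2.
  move=> ab; rewrite -[a ^+ 2]real_normK ?num_real// ler_pXn2r ?nnegrE//.
  exact: le_trans ab.
split.
  apply: l2norm_le => //; rewrite expr1n.
  apply: (@le_trans _ _ (l2norm x ^+ 2)); last by rewrite expr_le1 ?l2norm_ge0.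
  rewrite sqr_l2norm; apply: ler_sum => i _; rewrite mxE !sqr_normcE /= !ffunE /=.
  have [ci1 ci2] := coord1 i.
  by rewrite lerD// -[leRHS]real_normK ?num_real// sqr_le//; apply: (round_coordP _).1.
apply: l2norm_le; first by rewrite invr_ge0.
have -> : (4^-1 : R) ^+ 2 = \sum_(i < n) (mesh ^+ 2 + mesh ^+ 2).
  rewrite sumr_const card_ord mesh_sqr -[_ *+ n]mulr_natr natrM.
  by field; rewrite pnatr_eq0 -lt0n.
apply: ler_sum => i _; rewrite !mxE sqr_normcE !ffunE /=.
have [ci1 ci2] := coord1 i; move: ci1 ci2; case: (x i 0) => a b /= ci1 ci2.
by rewrite lerD// sqr_le//; apply: (round_coordP _).2.
Qed.

(* Approximating both arguments of the form within [1/4] costs at most half of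
   the norm, which is absorbed on the left. *)
Lemma opnorm_le_net (M : 'M[C]_n) (t : R) : 0 <= t ->
  (forall f g, in_net f -> in_net g ->
    complex.Re (\sum_i (grid_point g i 0)^* * (M *m grid_point f) i 0) <= t) ->
  opnorm M <= 2 * t.
Proof.
move=> t0 Mt; suff : opnorm M <= t + opnorm M / 2 by lra.
have N0 := opnorm_ge0 M.
apply: opnorm_le_form => [|x y x1 y1]; first by lra.
have [fN fx] := round_pointP x1; have [gN gy] := round_pointP y1.
have := Mt _ _ fN gN.
set x' := grid_point _ in fN fx *; set y' := grid_point _ in gN gy * => xy't.
have x'1 : l2norm x' <= 1 by [].
have -> : \sum_i (y i 0)^* * (M *m x) i 0 =
    \sum_i (y' i 0)^* * (M *m x') i 0
    + \sum_i ((y - y') i 0)^* * (M *m x') i 0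
    + \sum_i (y i 0)^* * (M *m (x - x')) i 0.
  rewrite -!big_split /=; apply: eq_bigr => i _.
  rewrite mulmxBr; move: (M *m x) (M *m x') => u v.
  by rewrite !mxE rmorphB /=; ring.
have le_form u v (c d : R) : l2norm u <= c -> l2norm v <= d -> c * d = 4^-1 ->
    complex.Re (\sum_i (u i 0)^* * (M *m v) i 0) <= opnorm M / 4.
  move=> uc vd cd; apply: le_trans (ler_norm _) _.
  apply: le_trans (ler_normc_Re _) _; apply: le_trans (normc_form_le _ _ _) _.
  by rewrite ler_wpM2l// -cd ler_pM ?l2norm_ge0.
rewrite !ReD.
have := le_form _ _ _ _ gy x'1 (mulr1 _).
have := le_form _ _ _ _ y1 fx (mul1r _).
move: xy't.
by move: (complex.Re _) (complex.Re _) (complex.Re _) => p q r; lra.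
Qed.

(** The squares of the [2 n] indices sum to at most [32 n], because [mesh ^+ 2] is [1 / (32 n)].
    Summing [8 m <= m^2 + 16] over them gives 8 times the sum at most [64 n]. *)
Lemma net_coord_sum (f : grid) : in_net f -> (\sum_k (f k).2 <= 8 * n)%N.
Proof.
rewrite /in_net => f1; have : l2norm (grid_point f) ^+ 2 <= 1.
  by rewrite expr_le1 ?l2norm_ge0.
rewrite sqr_l2norm.
have -> : \sum_i normc (grid_point f i 0) ^+ 2 =
    mesh ^+ 2 * (\sum_k (f k).2 ^ 2)%N%:R.
  rewrite natr_sum mulr_sumr (eq_bigr (fun i : 'I_n => \sum_(b : bool)
     mesh ^+ 2 * ((f (i, b)).2 ^ 2)%N%:R)); last first.
    move=> i _; rewrite big_bool /= mxE sqr_normcE /grid_coord /=.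
    by rewrite !exprMn !sqrr_sign !mul1r !natrX.
  by rewrite pair_big /=; apply: eq_bigr => -[].
rewrite mesh_sqr mulrC ler_pdivrMr ?ltr0n ?muln_gt0// mul1r ler_nat => le32.
rewrite -(leq_pmul2l (_ : 0 < 8)%N)//.
apply: (@leq_trans (\sum_(k : 'I_n * bool) ((f k).2 ^ 2 + 16))).
  rewrite big_distrr /=; apply: leq_sum => k _.
  by have := (nat_Cauchy (f k).2 4).1; rewrite mulnCA [X in (X <= _)%N -> _]mulnC.
rewrite big_split /= sum_nat_const card_prod card_ord card_bool.
by apply: leq_trans (leq_add le32 (leqnn _)) _; lia.
Qed.

Lemma sum_pow_half_le (K : nat) : \sum_(k < K) (2^-1 : R) ^+ k <= 2.
Proof.
suff -> : \sum_(k < K) (2^-1 : R) ^+ k = 2 - 2 * 2^-1 ^+ K.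
  by rewrite lerBlDr lerDl mulr_ge0// exprn_ge0// invr_ge0.
elim: K => [|K IH]; first by rewrite big_ord0 expr0 mulr1 subrr.
by rewrite big_ord_recr /= IH exprS; field.
Qed.

(* Weight each coordinate [k] by [2^-k]: the total weight of the grid is at most
   [4 ^ (2 n)], and each point of the net weighs at least [2^-(8 n)]. *)
Lemma card_net_le : (#|in_net|)%:R <= (2 : R) ^+ (12 * n).
Proof.
rewrite -sum1_card natr_sum.
apply: (@le_trans _ _ (\sum_(f : grid) 2 ^+ (8 * n) * \prod_k (2^-1 : R) ^+ (f k).2)).
  rewrite big_mkcond /=; apply: ler_sum => f _.
  have w0 : 0 <= \prod_k (2^-1 : R) ^+ (f k).2.
    by apply: prodr_ge0 => k _; rewrite exprn_ge0// invr_ge0.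
  case: ifPn => [fN|_]; last by rewrite mulr_ge0// exprn_ge0.
  rewrite prodrXr exprVn ler_pdivlMr ?exprn_gt0// mul1r.
  by rewrite ler_eXn2l ?ltr1n// net_coord_sum.
rewrite -mulr_sumr -(bigA_distr_bigA (fun (_ : 'I_n * bool) (p : bool * 'I_(32 * n).+1) =>
  (2^-1 : R) ^+ p.2)) /=.
(* The factor [2 ^+ (8 * n)] compensates the least weight of a net point; each of the [2 n]
   coordinates contributes at most 4, two signs times a geometric sum below 2. *)
have -> : (12 * n = 8 * n + 4 * n)%N by lia.
rewrite exprD ler_pM2l ?exprn_gt0//.
rewrite prodr_const card_prod card_ord card_bool.
have -> : (2 : R) ^+ (4 * n) = 4 ^+ (n * 2).
  have -> : (4 : R) = 2 ^+ 2 by rewrite expr2 -natrM.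
  by rewrite -exprM; congr (_ ^+ _); lia.
have s_ge0 : 0 <= \sum_(p : bool * 'I_(32 * n).+1) (2^-1 : R) ^+ p.2.
  by apply: sumr_ge0 => p _; rewrite exprn_ge0// invr_ge0.
rewrite ler_pXn2r ?nnegrE//; last by lia.
rewrite -(pair_bigA _ (fun (_ : bool) (k : 'I_(32 * n).+1) => (2^-1 : R) ^+ k)) /=.
by rewrite big_bool /=; have := sum_pow_half_le (32 * n).+1; lra.
Qed.

End GridNet.

(** * Independence and Gaussian tails *)

Section NonnegExtension.
Import HBNNSimple.
Context (d d' : measure_display) (T : measurableType d) (Y : measurableType d').
Context (R : realType).
Variables (mu : {measure set T -> \bar R}) (nu : {measure set Y -> \bar R}).
Variables (h : T -> R) (X : T -> Y) (c : R).
Hypotheses (mh : measurable_fun setT h) (h0 : forall w, 0 <= h w).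
Hypothesis mX : measurable_fun setT X.
Hypothesis hXE : forall B, measurable B ->
  (\int[mu]_w (h w * \1_B (X w))%:E = c%:E * nu B)%E.

Let measurable_prodX (g : Y -> R) : measurable_fun setT g ->
  measurable_fun setT (fun w => h w * g (X w)).
Proof. by move=> mg; apply: measurable_funM => //; exact: measurableT_comp. Qed.

Let ge0_integral_nnsfun (g : {nnsfun Y >-> R}) :
  (\int[mu]_w (h w * g (X w))%:E = c%:E * \int[nu]_y (g y)%:E)%E.
Proof.
have mind r : measurable (g @^-1` [set r]) by [].
transitivity (\sum_(r \in range g)
    \int[mu]_w (r * (h w * \1_(g @^-1` [set r]) (X w)))%:E)%E.
  rewrite -ge0_integral_fsum//; last 2 first.
  - move=> r; apply/measurable_EFinP.
    apply: measurable_funM => //.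
    by apply: measurable_prodX; exact: measurable_indic.
  - move=> r w _; rewrite lee_fin mulrCA mulr_ge0//.
    by have := nnfun_muleindic_ge0 g r (X w); rewrite -EFinM lee_fin.
  apply: eq_integral => w _.
  under eq_fsbigr do rewrite mulrCA EFinM.
  rewrite -ge0_mule_fsumr; last by move=> r; exact: nnfun_muleindic_ge0.
  by rewrite EFinM fimfunE -fsumEFin.
under [in RHS]eq_integral do rewrite fimfunE -fsumEFin//.
rewrite ge0_integral_fsum//; last 2 first.
  - by move=> r; exact/measurable_EFinP/measurableT_comp.
  - by move=> r y _; exact: nnfun_muleindic_ge0.
rewrite ge0_mule_fsumr; last first.
  by move=> r; apply: integral_ge0 => y _; exact: nnfun_muleindic_ge0.
apply: eq_fsbigr => r /[!inE] -[y _ <-].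
under eq_integral do rewrite EFinM.
rewrite ge0_integralZl//; last 3 first.
- by apply/measurable_EFinP; apply: measurable_prodX; exact: measurable_indic.
- by move=> w _; rewrite lee_fin mulr_ge0.
- by rewrite lee_fin.
rewrite hXE// integralZl_indic_nnsfun// integral_indic// setIT.
by rewrite muleCA.
Qed.

(** From indicators to simple functions by linearity, then to nonnegative measurable functions by
    monotone convergence. It serves both to release one factor of an independent product and to
    integrate against the normal density. *)
Lemma ge0_integral_extension (g : Y -> R) : measurable_fun setT g ->
  (forall y, 0 <= g y) ->
  (\int[mu]_w (h w * g (X w))%:E = c%:E * \int[nu]_y (g y)%:E)%E.
Proof.
move=> mg g0; have mEg : measurable_fun setT (EFin \o g) by exact/measurable_EFinP.
pose f_ := nnsfun_approx measurableT mEg.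
have fcvg y : (EFin \o f_ n) y @[n --> \oo] --> (g y)%:E.
  by apply: (cvg_nnsfun_approx measurableT mEg) => // *; rewrite lee_fin.
have fnd y : {homo (fun n => f_ n y) : m n / (m <= n)%N >-> m <= n}.
  by move=> m n mn; exact/lefP/nd_nnsfun_approx.
have -> : (\int[nu]_y (g y)%:E = limn (fun n => \int[nu]_y (f_ n y)%:E))%E.
  rewrite -monotone_convergence//=.
  - by apply: eq_integral => y _; apply/esym/cvg_lim => //; exact: fcvg.
  - by move=> n; exact/measurable_EFinP.
  - by move=> n y _; rewrite lee_fin.
  - by move=> y _ m n mn; rewrite lee_fin fnd.
have -> : (\int[mu]_w (h w * g (X w))%:E =
    limn (fun n => \int[mu]_w (h w * f_ n (X w))%:E))%E.
  rewrite -monotone_convergence//=.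
  - apply: eq_integral => w _; apply/esym/cvg_lim => //.
    rewrite EFinM; under eq_fun do rewrite EFinM.
    by apply: cvgeZl => //; exact: fcvg.
  - by move=> n; exact/measurable_EFinP/measurable_prodX.
  - by move=> n w _; rewrite lee_fin mulr_ge0.
  - by move=> w _ m n mn; rewrite lee_fin ler_wpM2l// fnd.
rewrite -limeMl//.
  by congr (limn _); apply/funext => n /=; rewrite ge0_integral_nnsfun.
apply/ereal_nondecreasing_is_cvgn => m n mn; apply: ge0_le_integral => //.
- by move=> y _; rewrite lee_fin.
- exact/measurable_EFinP.
- exact/measurable_EFinP.
- by move=> y _; rewrite lee_fin fnd.
Qed.

End NonnegExtension.

(** * Expectation of a product of independent variables *)

Section Independence.
Context (d d' : measure_display) (T : measurableType d) (Y : measurableType d').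
Context (R : realType) (P : probability T R) (I : finType) (X : I -> T -> Y).
Variable nu : I -> probability Y R.
Hypotheses (mX : forall k, measurable_fun setT (X k))
  (XE : forall k B, measurable B -> P (X k @^-1` B) = nu k B)
  (indepX : forall B : I -> set Y, (forall k, measurable (B k)) ->
    fine (P [set w | forall k, B k (X k w)]) = \prod_k fine (P (X k @^-1` B k))).

(* Induction on the set [s] of indices whose factor is not an indicator. *)
Let integral_prod_indep_seq (s : seq I) (g : I -> Y -> R) (m : I -> R) :
  (forall k, measurable_fun setT (g k)) -> (forall k x, 0 <= g k x) ->
  (forall k, \int[nu k]_x (g k x)%:E = (m k)%:E)%E ->
  (forall k, k \notin s -> exists2 B, measurable B & g k = \1_B) ->
  (\int[P]_w (\prod_k g k (X k w))%:E = (\prod_k m k)%:E)%E.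
Proof.
elim: s g m => [|k0 s IH] g m mg g0 gm gs.
  (* When all factors are indicators, the product is the indicator of one event, whose probability
     factors by hypothesis. *)
  have /(@choice _ _ (fun k B => measurable B /\ g k = \1_B))[B Bg] :
      forall k, exists B, measurable B /\ g k = \1_B.
    by move=> k; have [B mB ->] := gs k isT; exists B.
  have mB k : measurable (B k) := (Bg k).1.
  pose E := [set w | forall k, B k (X k w)].
  have mE : measurable E.
    have -> : E = \big[setI/setT]_(k : I) (X k @^-1` B k).
      rewrite -bigcap_seq; apply/seteqP; split=> w /= Ew k //=.
      by apply: Ew => /=; exact: mem_index_enum.
    apply: bigsetI_measurable => k _.
    by rewrite -[_ @^-1` _]setTI; exact: mX.
  transitivity (\int[P]_w (\1_E w)%:E)%E.
    apply: eq_integral => w _; congr (_%:E); rewrite indicE.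
    have [Ew|nEw] := pselect (E w).
      rewrite mem_set// big1// => k _.
      by rewrite (Bg k).2 indicE mem_set//; exact: Ew.
    rewrite memNset//; have /existsNP[k nk] := nEw.
    by rewrite (bigD1 k)//= (Bg k).2 indicE memNset// mul0r.
  rewrite integral_indic// setIT -[LHS]fineK ?fin_num_measure//.
  rewrite indepX//; congr (_%:E); apply: eq_bigr => k _.
  rewrite XE//; have := gm k; rewrite (Bg k).2 integral_indic// setIT => ->//.
pose c := \prod_(k | k != k0) m k.
pose h w := \prod_(k | k != k0) g k (X k w).
have mh : measurable_fun setT h.
  rewrite /h; under eq_fun do rewrite -big_filter.
  by apply: measurable_prod => k _; exact: measurableT_comp.
have h0 w : 0 <= h w by apply: prodr_ge0.
transitivity (\int[P]_w (h w * g k0 (X k0 w))%:E)%E.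
  by apply: eq_integral => w _; rewrite (bigD1 k0)//= mulrC.
rewrite (@ge0_integral_extension _ _ _ _ _ P (nu k0) h (X k0) c)//.
  by rewrite gm -EFinM (bigD1 k0)//= mulrC.
move=> B mB.
(* The condition on indicators required by the extension is the induction hypothesis with the factor
   at [k0] replaced by [\1_B]. *)
pose g' k := if k == k0 then \1_B else g k.
pose m' k := if k == k0 then fine (nu k0 B) else m k.
transitivity (\int[P]_w (\prod_k g' k (X k w))%:E)%E.
  apply: eq_integral => w _; congr (_%:E); rewrite (bigD1 k0)//= /g' eqxx mulrC.
  by congr (_ * _); apply: eq_bigr => k /negbTE ->.
rewrite (IH g' m').
- rewrite (bigD1 k0)//= /m' eqxx EFinM muleC fineK ?fin_num_measure//.
  by congr (_%:E * _)%E; apply: eq_bigr => k /negbTE ->.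
- by move=> k; rewrite /g'; case: eqP => // _; exact: measurable_indic.
- by move=> k x; rewrite /g'; case: eqP.
- move=> k; rewrite /g' /m'; case: eqP => [->|//].
  by rewrite integral_indic// setIT fineK// fin_num_measure.
- move=> k ks; rewrite /g'; case: eqP => [_|/eqP kk0]; first by exists B.
  by apply: gs; rewrite inE negb_or kk0.
Qed.

Lemma integral_prod_indep (g : I -> Y -> R) (m : I -> R) :
  (forall k, measurable_fun setT (g k)) -> (forall k x, 0 <= g k x) ->
  (forall k, \int[nu k]_x (g k x)%:E = (m k)%:E)%E ->
  (\int[P]_w (\prod_k g k (X k w))%:E = (\prod_k m k)%:E)%E.
Proof.
move=> mg g0 gm; apply: (integral_prod_indep_seq (s := index_enum I)) => // k.
by rewrite mem_index_enum.
Qed.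

End Independence.

(** * Gaussian moment generating function and tail bound *)

Section GaussianTail.
Variable R : realType.

(** Completing the square: [expR (theta * x)] times the centred density is a constant times the
    density with mean [theta * sigma ^+ 2], which integrates to 1. *)
Lemma normal_mgf (sigma theta : R) : sigma != 0 ->
  (\int[normal_prob 0 sigma]_x (expR (theta * x))%:E
    = (expR (theta ^+ 2 * sigma ^+ 2 / 2))%:E)%E.
Proof.
move=> s0.
have mexp : measurable_fun setT (fun x : R => expR (theta * x)).
  by apply: measurableT_comp => //; exact: measurable_funM.
have densityE (B : set R) : measurable B -> (\int[lebesgue_measure]_x
    (normal_pdf 0 sigma x * \1_B x)%:E = 1%:E * normal_prob 0 sigma B)%E.
  move=> mB; rewrite mul1e /normal_prob [RHS]integral_mkcond.
  apply: eq_integral => x _; rewrite patchE indicE.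
  by case: ifPn => _; rewrite ?mulr1 ?mulr0.
have := @ge0_integral_extension _ _ _ _ _ (@lebesgue_measure R)
  (normal_prob 0 sigma) _ _ _ (measurable_normal_pdf 0 sigma)
  (normal_pdf_ge0 0 sigma) (@measurable_id _ R setT) densityE _ mexp
  (fun x => expR_ge0 _).
rewrite mul1e => <-.
transitivity (\int[lebesgue_measure]_x
    ((expR (theta ^+ 2 * sigma ^+ 2 / 2))%:E *
     (normal_pdf (theta * sigma ^+ 2) sigma x)%:E))%E.
  apply: eq_integral => x _; rewrite -EFinM !normal_pdfE//.
  rewrite mulrCA -[in LHS]mulrA; congr ((_ * _)%:E).
  by rewrite /normal_fun -!expRD; congr expR; field.
rewrite ge0_integralZl//.
- by rewrite integral_normal_pdf mule1.
- by apply/measurable_EFinP; exact: measurable_normal_pdf.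
- by move=> x _; rewrite lee_fin normal_pdf_ge0.
Qed.

Context (d : measure_display) (T : measurableType d) (P : probability T R).

Lemma measurable_linear_form (I : finType) (X : I -> T -> R) (a : I -> R) :
  (forall k, measurable_fun setT (X k)) ->
  measurable_fun setT (fun w => \sum_k a k * X k w).
Proof. by move=> mX; apply: measurable_sum => k; exact: measurable_funM. Qed.

(** Chernoff bound: the indicator of the event is at most the exponential of [theta] times the
    excess over [t], whose expectation factors by independence. *)
Lemma gaussian_tail (n : nat) (s t : R) (G : T -> 'M[R[i]]_n)
    (a : 'I_n * 'I_n * bool -> R) : (0 < n)%N ->
  0 < s -> s ^+ 2 <= (2 * n%:R)^-1 -> 0 <= t ->
  iid_complex_normal P s G -> \sum_k a k ^+ 2 <= 1 ->
  (P [set w | (t <= \sum_k a k * mx_part G k w)%R]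
    <= (expR (- (2 * n%:R * t ^+ 2)))%:E)%E.
Proof.
move=> n0 s0 sn t0 [mG GE indepG] a1.
have n0' : 0 < n%:R :> R by rewrite ltr0n.
pose sigma := s / Num.sqrt 2.
have sigma0 : sigma != 0 by rewrite mulf_neq0 ?invr_eq0 ?gt_eqF ?sqrtr_gt0.
have sigma2 : sigma ^+ 2 = s ^+ 2 / 2 by rewrite exprMn exprVn sqr_sqrtr.
(* As [sigma ^+ 2 <= 1 / (4 n)], the exponent is at most [- theta t + theta^2 / (8 n)]; this [theta]
   minimizes it, with value [- 2 n t^2]. *)
pose theta := 4 * n%:R * t.
have theta0 : 0 <= theta by rewrite !mulr_ge0.
set E := [set w | _].
have mS := measurable_linear_form a mG.
have mE : measurable E.
  by rewrite -[E]setTI; apply: (measurable_fun_le measurableT) => //; exact: measurable_cst.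
have mexpS : measurable_fun setT
    (fun w => expR (theta * (\sum_k a k * mx_part G k w - t))).
  apply: measurableT_comp => //; apply: measurable_funM => //.
  exact: measurable_funB.
apply: (@le_trans _ _ (\int[P]_w
    (expR (theta * (\sum_k a k * mx_part G k w - t)))%:E)%E).
  have -> : P E = (\int[P]_w (\1_E w)%:E)%E by rewrite integral_indic// setIT.
  apply: ge0_le_integral => //.
  - exact/measurable_EFinP/measurable_indic.
  - exact/measurable_EFinP.
  - move=> w _; rewrite lee_fin indicE.
    have [Ew|nEw] := pselect (E w); last by rewrite memNset// expR_ge0.
    by rewrite mem_set// -[leLHS]expR0 ler_expR mulr_ge0// subr_ge0.
pose nu (_ : 'I_n * 'I_n * bool) : probability _ R := normal_prob 0 sigma.
have expR_sum (F : 'I_n * 'I_n * bool -> R) : expR (\sum_k F k) = \prod_k expR (F k).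
  by apply: (big_morph expR) => [x y|]; rewrite ?expRD ?expR0.
have -> : (\int[P]_w (expR (theta * (\sum_k a k * mx_part G k w - t)))%:E =
    (expR (- (theta * t)) * \prod_k expR ((theta * a k) ^+ 2 * sigma ^+ 2 / 2))%:E)%E.
  transitivity (\int[P]_w ((expR (- (theta * t)))%:E *
      (\prod_k expR (theta * a k * mx_part G k w))%:E))%E.
    apply: eq_integral => w _; rewrite -EFinM -expR_sum -expRD; congr (expR _)%:E.
    rewrite mulrBr addrC mulr_sumr; congr (_ + _).
    by apply: eq_bigr => k _; rewrite mulrA.
  rewrite ge0_integralZl//; last 2 first.
  - apply/measurable_EFinP; apply: measurable_prod => k _.
    apply: measurableT_comp => //.
    by apply: measurable_funM => //; exact: mG.
  - by move=> w _; rewrite lee_fin prodr_ge0// => k _; exact: expR_ge0.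
  rewrite (@integral_prod_indep _ _ _ _ _ _ _ _ nu mG GE indepG
    (fun k x => expR (theta * a k * x))
    (fun k => expR ((theta * a k) ^+ 2 * sigma ^+ 2 / 2)))//.
  - by move=> k; apply: measurableT_comp => //; exact: measurable_funM.
  - by move=> k; exact: normal_mgf.
rewrite lee_fin -expR_sum -expRD ler_expR.
have -> : \sum_k (theta * a k) ^+ 2 * sigma ^+ 2 / 2 =
    theta ^+ 2 * sigma ^+ 2 / 2 * \sum_k a k ^+ 2.
  by rewrite mulr_sumr; apply: eq_bigr => k _; rewrite exprMn; ring.
have n4 : sigma ^+ 2 <= (4 * n%:R)^-1.
  by rewrite sigma2 ler_pdivrMr// (le_trans sn)// le_eqVlt; apply/orP; left;
     apply/eqP; field; rewrite gt_eqF.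
apply: (@le_trans _ _ (- (theta * t) + theta ^+ 2 * (4 * n%:R)^-1 / 2)).
  rewrite lerD2l; apply: (@le_trans _ _ (theta ^+ 2 * sigma ^+ 2 / 2)).
    by rewrite ler_piMr// divr_ge0// -exprMn sqr_ge0.
  by rewrite ler_pM2r// ler_wpM2l ?sqr_ge0.
rewrite le_eqVlt; apply/orP; left; apply/eqP; rewrite /theta; field.
by rewrite gt_eqF.
Qed.

End GaussianTail.

(** * Spectral norm of a complex Gaussian matrix *)

Section GaussianNorm.
Variable R : realType.
Local Notation C := R[i].

Lemma measure_bigsetU_le (d : measure_display) (T : measurableType d)
    (mu : {measure set T -> \bar R}) (I : Type) (s : seq I) (A : I -> set T) :
  (forall k, measurable (A k)) ->
  (mu (\big[setU/set0]_(k <- s) A k) <= \sum_(k <- s) mu (A k))%E.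
Proof.
move=> mA; elim: s => [|k s IH]; first by rewrite !big_nil measure0.
rewrite !big_cons; apply: le_trans (measureU2 _ _ _) _ => //.
  exact: bigsetU_measurable.
exact: leeD2l.
Qed.

(** Coefficients of the real part of the form of [G] at [x] and [y], viewed as a real linear form in
    the real and imaginary parts of the entries of [G]. *)
Definition form_coef n (x y : 'cV[C]_n) (k : 'I_n * 'I_n * bool) : R :=
  let c := (y k.1.1 0)^* * x k.1.2 0 in
  if k.2 then complex.Re c else - complex.Im c.

Lemma sum_index_pairs n (F : 'I_n * 'I_n * bool -> R) :
  \sum_k F k = \sum_i \sum_j (F (i, j, true) + F (i, j, false)).
Proof.
rewrite pair_bigA /=.
rewrite (eq_bigr (fun p : 'I_n * 'I_n => \sum_b F (p, b))); last first.
  by move=> [i j] _; rewrite big_bool.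
by rewrite pair_bigA /=; apply: eq_bigr => -[].
Qed.

Lemma form_coefE n (x y : 'cV[C]_n) (d : measure_display) (T : measurableType d)
    (G : T -> 'M[C]_n) (w : T) :
  complex.Re (\sum_i (y i 0)^* * (G w *m x) i 0)
    = \sum_k form_coef x y k * mx_part G k w.
Proof.
rewrite sum_index_pairs Re_sum; apply: eq_bigr => i _.
rewrite mxE mulr_sumr Re_sum; apply: eq_bigr => j _.
rewrite /form_coef /mx_part /= mulrCA.
case: ((y i 0)^* * x j 0) => a b; case: (G w i j) => a' b' /=.
by ring.
Qed.

(** The squared Frobenius norm of a rank-one matrix. It is at most 1 on the net, the normalization
    asked by [gaussian_tail]. *)
Lemma sum_form_coef_sqr n (x y : 'cV[C]_n) :
  \sum_k form_coef x y k ^+ 2 = (l2norm y * l2norm x) ^+ 2.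
Proof.
rewrite sum_index_pairs exprMn !sqr_l2norm big_distrlr /=.
apply: eq_bigr => i _; apply: eq_bigr => j _; rewrite /form_coef /=.
by rewrite -exprMn -(normc_conj (y i 0)) -normcM sqr_normcE sqrrN.
Qed.

(** [(1 + 7/24)^3 > 2]. The exponent 7/8 makes [2^(24 n)] at most [e^(21 n)], below the tail
    exponent [24 n] with room to spare. *)
Lemma two_le_expR : 2 <= expR (7 / 8 : R).
Proof.
have -> : (7 / 8 : R) = 7 / 24 * 3 by field.
rewrite expRM_natr.
have /(lerXn2r 3) : (1 + 7 / 24 : R) <= expR (7 / 24) by exact: expR_ge1Dx.
rewrite !nnegrE expR_ge0 => /(_ _ isT) h; apply: le_trans (h _); lra.
Qed.

(** The product is at most [e^(21 n) e^(-24 n) = e^(-3 n)], and [e^(3 n) >= 1 + 3 n] exceeds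
    [n / 3]. *)
Lemma net_union_bound (n : nat) : (0 < n)%N ->
  (2 : R) ^+ (12 * n) * 2 ^+ (12 * n) * expR (- (2 * n%:R * (7 / 2) ^+ 2)) <= 3 / n%:R.
Proof.
move=> n0; have n0' : 0 < n%:R :> R by rewrite ltr0n.
rewrite -exprD; have -> : (12 * n + 12 * n = n * 24)%N by lia.
apply: (@le_trans _ _ (expR (7 / 8 * (n * 24)%:R) * expR (- (24 * n%:R)))).
  apply: ler_pM; rewrite ?exprn_ge0 ?expR_ge0//.
    by rewrite expRM_natr lerXn2r ?nnegrE ?expR_ge0// two_le_expR.
  by rewrite ler_expR; nra.
rewrite -expRD natrM.
have -> : 7 / 8 * (n%:R * 24) + - (24 * n%:R) = - (3 * n%:R) :> R by field.
rewrite expRN ler_pdivlMr// mulrC ler_pdivrMr ?expR_gt0//.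
have := expR_ge1Dx (3 * n%:R : R); lra.
Qed.

Lemma gaussian_opnorm (d : measure_display) (T : measurableType d)
    (P : probability T R) (n : nat) (s : R) (G : T -> 'M[C]_n) : (0 < n)%N ->
  0 < s -> s ^+ 2 <= (2 * n%:R)^-1 -> iid_complex_normal P s G ->
  exists S : set T, [/\ measurable S, ((1 - 3 / n%:R)%:E <= P S)%E &
    forall w, S w -> opnorm (G w) <= 7].
Proof.
move=> n0 s0 sn Giid; have [mG _ _] := Giid.
(* The level 7/2 is half of 7 because passing from the net to the norm doubles the bound. *)
pose bad (p : grid n * grid n) : set T :=
  [set w | (7 / 2 <= \sum_k form_coef (grid_point R p.1) (grid_point R p.2) k
    * mx_part G k w)%R].
pose net := [seq p <- index_enum (grid n * grid n)%type
  | in_net R p.1 && in_net R p.2].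
have mbad p : measurable (bad p).
  rewrite -[bad p]setTI; apply: (measurable_fun_le measurableT).
    exact: measurable_cst.
  exact: measurable_linear_form.
pose B := \big[setU/set0]_(p <- net) bad p.
have mB : measurable B by exact: bigsetU_measurable.
exists (~` B); split; first exact: measurableC.
  rewrite probability_setC// EFinB leeB//.
  apply: le_trans (measure_bigsetU_le _ _ mbad) _.
  apply: (@le_trans _ _ (\sum_(p <- net) (expR (- (2 * n%:R * (7 / 2) ^+ 2)))%:E)%E).
    rewrite big_seq [leRHS]big_seq; apply: lee_sum => p.
    rewrite mem_filter => /andP[/andP[p1 p2] _].
    apply: (@gaussian_tail _ _ _ _ _ s) => //.
    by rewrite sum_form_coef_sqr expr_le1 ?mulr_ge0 ?mulr_ile1 ?l2norm_ge0.
  rewrite sumEFin lee_fin big_const_seq count_predT iter_addr_0 -[leLHS]mulr_natl.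
  apply: le_trans (net_union_bound n0); apply: ler_wpM2r; first exact: expR_ge0.
  have -> : size net = (#|@in_net R n| * #|@in_net R n|)%N.
    rewrite size_filter -sum1_count /=.
    rewrite -(pair_big (@in_net R n) (@in_net R n) (fun _ _ => 1%N)) /=.
    rewrite (eq_bigr (fun=> #|@in_net R n|)); last first.
      by move=> f _; exact: (sum1_card (@in_net R n)).
    exact: (sum_nat_const (@in_net R n)).
  by rewrite natrM ler_pM// card_net_le.
move=> w nBw; have -> : 7 = 2 * (7 / 2) :> R by field.
apply: opnorm_le_net => //.
move=> f g fN gN; rewrite form_coefE leNgt; apply/negP => /ltW badw; apply: nBw.
rewrite /B -bigcup_seq; exists (f, g) => //=.
by rewrite mem_filter /= fN gN mem_index_enum.
Qed.

End GaussianNorm.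

(** * Lower bound on the cost of matrix multiplication *)

Section MatrixMultiplicationCost.
Variable R : realType.
Local Notation C := R[i].

Lemma size_slp_run (ev : arith_op -> C -> C -> C) (st : C -> C) code r :
  size (foldl (slp_step ev st) r code) = (size r + size code)%N.
Proof.
by elim: code r => [|x code IH] r /=; rewrite ?addn0// IH size_rcons addSnnS.
Qed.

Lemma nth_slp_run (ev : arith_op -> C -> C -> C) (st : C -> C) code r k :
  (k < size r)%N -> nth 0 (foldl (slp_step ev st) r code) k = nth 0 r k.
Proof.
elim: code r => [//|x code IH] r lt_kr /=; rewrite IH ?size_rcons; last by lia.
by rewrite nth_rcons lt_kr.
Qed.

Lemma size_mx_entries n (A : 'M[C]_n) : size (mx_entries A) = (n * n)%N.
Proof. by rewrite size_allpairs size_enum_ord. Qed.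

Lemma mx_entriesZ n (A : 'M[C]_n) (c : C) :
  mx_entries (c *: A) = [seq c * z | z <- mx_entries A].
Proof.
rewrite /mx_entries map_allpairs; apply: eq_allpairs => i j.
by rewrite mxE.
Qed.

(* The [n ^ 2] outputs are pairwise distinct functions of the inputs, and none
   of them is an input since they are homogeneous of degree 2. *)
Lemma mm_ops_ge n (p : mm_prog R n) : mm_correct p -> (n * n <= mm_ops p)%N.
Proof.
move=> [_ correct].
pose regs (A B : 'M[C]_n) := foldl (slp_step (@exact_op R) id)
  (mx_entries A ++ mx_entries B) (slp_code p).
have outE A B i j : nth 0 (regs A B) (slp_out p i j) = (A *m B) i j.
  by rewrite -correct mxE.
have szr A B : size (regs A B) = (n * n + n * n + mm_ops p)%N.
  by rewrite size_slp_run size_cat !size_mx_entries.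
(* The product of [L i] and [K i j] is the elementary matrix at [(i, j)]: these inputs isolate one
   output. *)
pose L i : 'M[C]_n := delta_mx i i; pose K i j : 'M[C]_n := delta_mx i j.
have LK i j i' j' : (L i *m K i j) i' j' = ((i' == i) && (j' == j))%:R.
  by rewrite mul_delta_mx mxE.
(* A register out of range would read the default 0, whereas this entry of the product is 1. *)
have out_lt i j : (slp_out p i j < n * n + n * n + mm_ops p)%N.
  rewrite ltnNge; apply/negP => ge; have := outE (L i) (K i j) i j.
  by rewrite nth_default ?szr// LK !eqxx => /eqP; rewrite eq_sym oner_eq0.
have out_ge i j : (n * n + n * n <= slp_out p i j)%N.
  rewrite leqNgt; apply/negP => lt.
  have := outE (2 *: L i) (2 *: K i j) i j; have := outE (L i) (K i j) i j.
  have lt' (A B : 'M[C]_n) : (slp_out p i j < size (mx_entries A ++ mx_entries B))%N.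
    by rewrite size_cat !size_mx_entries.
  rewrite /regs !nth_slp_run// !mx_entriesZ -map_cat (nth_map 0)// => ->.
  rewrite -scalemxAl -scalemxAr scalerA [RHS]mxE LK !eqxx !mulr1.
  by rewrite -natrM => /eqP; rewrite eqr_nat.
pose f (k : 'I_n * 'I_n) : 'I_(mm_ops p) :=
  Ordinal (ltac:(have := out_lt k.1 k.2; have := out_ge k.1 k.2; lia) :
    (slp_out p k.1 k.2 - (n * n + n * n) < mm_ops p)%N).
have f_inj : injective f.
  move=> [i j] [i' j'] /(congr1 val) /=.
  have := out_ge i j; have := out_ge i' j' => ge' ge eq_out.
  have {}eq_out : slp_out p i j = slp_out p i' j' by lia.
  have := outE (L i) (K i j) i j; rewrite eq_out outE !LK !eqxx.
  by case: eqP => [->|_]; case: eqP => [->|_] //= /eqP; rewrite eq_sym oner_eq0.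
by have := leq_card f f_inj; rewrite card_prod !card_ord.
Qed.

End MatrixMultiplicationCost.

(** * Forward error of the algorithm *)

Section ForwardError.
Local Open Scope sesquilinear_scope.
Variable R : realType.
Local Notation C := R[i].

(** The expansion has seven monomials, each of modulus at most [u] because [u <= 1]. *)
Lemma rounding_product_le (u : R) (d1 d2 d3 : C) : 0 <= u <= 1 ->
  normc d1 <= u -> normc d2 <= u -> normc d3 <= u ->
  normc ((1 + d1) * (1 + d2) * (1 + d3) - 1) <= 7 * u.
Proof.
move=> /andP[u0 u1] d1u d2u d3u.
have -> : (1 + d1) * (1 + d2) * (1 + d3) - 1 =
    d1 + (d2 + (d3 + (d1 * d2 + (d1 * d3 + (d2 * d3 + d1 * d2 * d3))))) by ring.
have n0 := @normc_ge0 R.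
have le_mul (x y : C) : normc x <= u -> normc y <= u -> normc (x * y) <= u.
  by move=> xu yu; rewrite normcM -[leRHS]mulr1 ler_pM// (le_trans yu).
have -> : 7 * u = u + (u + (u + (u + (u + (u + u))))) by ring.
apply: le_trans (le_normcD _ _) _; apply: lerD => //.
apply: le_trans (le_normcD _ _) _; apply: lerD => //.
apply: le_trans (le_normcD _ _) _; apply: lerD => //.
apply: le_trans (le_normcD _ _) _; apply: lerD; first exact: le_mul.
apply: le_trans (le_normcD _ _) _; apply: lerD; first exact: le_mul.
apply: le_trans (le_normcD _ _) _; apply: lerD; first exact: le_mul.
exact: (le_mul _ _ (le_mul _ _ d1u d2u) d3u).
Qed.

(** The error is [d3 * a] plus [g] times the sum of [(D - 1) * z] and [z - w]. The constants are
    [99 = 1 + 7 * 14] and [16 = 7 * 2 + 2]. *)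
Lemma shatter_entry_error (u c g : R) (a w z d1 d2 d3 : C) :
  0 <= u <= 1 -> 0 <= c -> 0 <= g <= 1 ->
  normc d1 <= u -> normc d2 <= u -> normc d3 <= u ->
  normc a <= 1 -> normc w <= 14 -> normc (z - w) <= 2 * (c * u) ->
  normc ((1 + d3) * (a + (1 + d2) * (g%:C * ((1 + d1) * z))) - (a + g%:C * w))
    <= (99 + 16 * c) * u.
Proof.
move=> u01 c0 /andP[g0 g1] d1u d2u d3u a1 w14 zw; have /andP[u0 u1] := u01.
set D := (1 + d1) * (1 + d2) * (1 + d3).
have -> : (1 + d3) * (a + (1 + d2) * (g%:C * ((1 + d1) * z))) - (a + g%:C * w)
    = d3 * a + g%:C * ((D - 1) * z + (z - w)) by rewrite /D; ring.
have n0 := @normc_ge0 R.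
have z_le : normc z <= 14 + 2 * (c * u).
  have -> : z = w + (z - w) by ring.
  by apply: le_trans (le_normcD _ _) _; exact: lerD.
apply: (@le_trans _ _ (u + (7 * u * (14 + 2 * (c * u)) + 2 * (c * u)))).
  apply: le_trans (le_normcD _ _) _; apply: lerD.
    by rewrite normcM -[leRHS]mulr1 ler_pM.
  rewrite normcM normc_real_complex ger0_norm// -[leRHS]mul1r ler_pM//.
  apply: le_trans (le_normcD _ _) _; apply: lerD => //.
  by rewrite normcM ler_pM//; exact: rounding_product_le.
have cuu : c * u * u <= c * u by rewrite ler_piMr// mulr_ge0.
by lra.
Qed.

Lemma SHATTERH_E (u : R) (F : fp_arith u) tN n (A' : 'M[C]_n) (g : R) (Z : 'M[C]_n) i j :
  (SHATTERH F tN A' g Z).1 i j =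
  fl F Add (A' i j) (fl F Mul g%:C (fl F Add (Z i j) (Z j i)^*)).
Proof. by rewrite !mxE. Qed.

(** Nothing makes the roundings at [(i, j)] and [(j, i)] conjugate, so the computed matrix may fail
    to be Hermitian; it is compared with an exactly Hermitian one when [A'] is Hermitian. *)
Lemma SHATTERH_error (u c g e : R) (F : fp_arith u) tN n (A' Z G : 'M[C]_n) :
  0 <= u <= 1 -> 0 <= c -> 0 <= g <= 1 -> opnorm A' <= 1 ->
  opnorm (G + G^t* ) <= 14 -> e <= c * u ->
  (forall i j, normc (Z i j - G i j) <= e) ->
  opnorm ((SHATTERH F tN A' g Z).1 - (A' + g%:C *: (G + G^t* )))
    <= n%:R * ((99 + 16 * c) * u).
Proof.
move=> u01 c0 g01 A'1 W14 ecu ZG; have /andP[u0 u1] := u01.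
apply: opnorm_le_entries => [|i j].
  by rewrite mulr_ge0// addr_ge0// mulr_ge0.
have subE (M N : 'M[C]_n) : (M - N) i j = M i j - N i j by rewrite !mxE.
have addE (W : 'M[C]_n) : (A' + g%:C *: W) i j = A' i j + g%:C * W i j.
  by rewrite !mxE.
rewrite subE addE SHATTERH_E.
have [|d1 d1u ->] := @flE _ _ F Add (Z i j) (Z j i)^*; first by left.
have [|d2 d2u ->] := @flE _ _ F Mul g%:C
  ((1 + d1) * exact_op Add (Z i j) (Z j i)^*); first by left.
have [|d3 d3u ->] := @flE _ _ F Add (A' i j) ((1 + d2) *
  exact_op Mul g%:C ((1 + d1) * exact_op Add (Z i j) (Z j i)^*)); first by left.
rewrite /exact_op.
apply: shatter_entry_error => //.
- exact: le_trans (normc_entry_le _ _ _) A'1.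
- exact: le_trans (normc_entry_le _ _ _) W14.
- rewrite !mxE.
  have -> : Z i j + (Z j i)^* - (G i j + (G j i)^*) =
      (Z i j - G i j) + (Z j i - G j i)^* by rewrite rmorphB /=; ring.
  apply: le_trans (le_normcD _ _) _; rewrite normc_conj mulr_natl mulr2n.
  by apply: lerD; exact: le_trans (ZG _ _) ecu.
Qed.

Lemma hermsymmx_symmetrize n (G : 'M[C]_n) : G + G^t* \is hermsymmx.
Proof. by apply/hermsymmxP; rewrite raddfD /= map_mxD trmxCK addrC. Qed.

Lemma hermsymmxD n (A B : 'M[C]_n) :
  A \is hermsymmx -> B \is hermsymmx -> A + B \is hermsymmx.
Proof.
by move=> /hermsymmxP hA /hermsymmxP hB; apply/hermsymmxP; rewrite raddfD /= map_mxD hA hB.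
Qed.

Lemma hermsymmxZ n (A : 'M[C]_n) (a : R) :
  A \is hermsymmx -> a%:C *: A \is hermsymmx.
Proof.
move=> /hermsymmxP hA; apply/hermsymmxP.
have conjZ (x : C) : (a%:C * x)^* = a%:C * x^*.
  by case: x => [? ?]; simpc; congr (_ +i* _); ring.
apply/matrixP => i j; move/matrixP/(_ i j): hA.
by rewrite !mxE => hA; apply: etrans (conjZ _) _; congr (_ * _).
Qed.

Lemma Re_eigenvalues_scale n (A : 'M[C]_n) (c : R) : A \is hermsymmx ->
  perm_eq (Re_eigenvalues (c%:C *: A)) [seq c * x | x <- Re_eigenvalues A].
Proof.
move=> /hermitian_diagonalization[P [a [Pu -> pa]]].
have -> : c%:C *: (P^t* *m real_diag a *m P) =
    P^t* *m real_diag (fun i => c * a i) *m P.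
  have -> : real_diag (fun i => c * a i) = c%:C *: real_diag a.
    apply/matrixP => i j; rewrite !mxE.
    by case: eqP => _; rewrite ?mulr0n ?mulr0// !mulr1n rmorphM.
  by rewrite -scalemxAr -scalemxAl.
have tr : is_trig_mx (real_diag (fun i => c * a i)) by exact: diag_mx_is_trig.
apply: perm_trans (Re_eigenvalues_trig Pu tr) _.
rewrite perm_sym; apply: perm_trans (perm_map _ pa) _.
rewrite -map_comp; apply/permP => q; congr count; apply: eq_map => i /=.
by rewrite mxE eqxx mulr1n mxE.
Qed.

Lemma eigenvalues_within_perturbation n (A W X : 'M[C]_n) (g delta : R)
    (VD : 'M[C]_n * 'rV[C]_n) : (0 < n)%N ->
  A \is hermsymmx -> W \is hermsymmx -> opnorm W <= 14 -> 0 <= g ->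
  n%:R * delta <= g ->
  opnorm (X - ((16^-1)%:C *: A + g%:C *: W)) <= delta ->
  eig_success X delta VD ->
  eigenvalues_within A (\matrix_(i < 1, j < n) (Phi R * complex.Re (VD.2 i j)))
    (256 * g).
Proof.
move=> n0 Ah Wh W14 g0 ndg XH [Vu MX _] i lt_in.
have A'h := hermsymmxZ (16^-1) Ah; have gWh := hermsymmxZ g Wh.
move: XH; set A' := _ *: A in A'h *; set gW := _ *: W in gWh *.
have gW_le : opnorm gW <= g * 14.
  apply: le_trans (opnormZ_le _ _) _.
  by rewrite normc_real_complex ger0_norm// ler_wpM2l.
clearbody gW; have Hh := hermsymmxD A'h gWh.
have dAH : count_dominated (g * 14) (Re_eigenvalues A') (Re_eigenvalues (A' + gW)).
  by apply: (weyl_count A'h Hh); rewrite opprD addNKr opnormN.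
have dHA : count_dominated (g * 14) (Re_eigenvalues (A' + gW)) (Re_eigenvalues A').
  by apply: (weyl_count Hh A'h); rewrite addrAC subrr add0r.
move: (A' + gW) Hh dAH dHA => H Hh dAH dHA XH.
have pM : perm_eq (Re_eigenvalues (VD.1 *m diag_mx VD.2 *m invmx VD.1))
    [seq complex.Re (VD.2 0 j) | j <- enum 'I_n].
  have := perm_map (@complex.Re R) (eigenvalues_trig Vu (diag_mx_is_trig VD.2)).
  rewrite -map_comp /=.
  rewrite [X in perm_eq _ X -> _](_ : _ = [seq complex.Re (VD.2 0 j) | j <- enum 'I_n])//.
  by apply: eq_map => j /=; rewrite mxE eqxx mulr1n.
move: (VD.1 *m _ *m _) MX pM => M MX pM.
have MH : opnorm (M - H) <= delta + delta.
  have -> : M - H = - (X - M) + (X - H) by rewrite opprB addrA subrK.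
  by apply: (le_trans (opnormD _ _)); rewrite opnormN; exact: (lerD MX XH).
have [dHM dMH] := nonhermitian_perturbation n0 Hh MH.
have pA := Re_eigenvalues_scale (16^-1) Ah.
(* Weyl's inequality contributes [14 g]; the non-Hermitian step contributes [2 n delta], at most
   [2 g]. Multiplying by [Phi] then gives [256 g]. *)
have bound : g * 14 + n%:R * (delta + delta) <= 16 * g.
  by rewrite [n%:R * _]mulrDr; move: ndg; clear; move: (n%:R * delta) => p pg; lra.
have unscale (s : seq R) : [seq 16 * x | x <- [seq 16^-1 * x | x <- s]] = s.
  by rewrite -map_comp map_id_in// => x _ /=; rewrite mulVKf.
have lamE : [seq (\matrix_(i < 1, j < n) (Phi R * complex.Re (VD.2 i j))) 0 j | j <- enum 'I_n]
    = [seq 16 * x | x <- [seq complex.Re (VD.2 0 j) | j <- enum 'I_n]].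
  by rewrite -[RHS]map_comp; apply: eq_map => j /=; rewrite mxE.
have -> : 256 * g = 16 * (16 * g) by ring.
rewrite lamE; apply: count_dominated_dist.
- by rewrite size_map size_eigenvalues 2!size_map size_enum_ord.
- by rewrite size_map size_eigenvalues.
- rewrite -/(Re_eigenvalues A) -[Re_eigenvalues A]unscale.
  apply: count_dominated_scale => //.
  apply: (count_dominated_perm pA pM); apply: (count_dominatedW bound).
  exact: count_dominated_trans dAH dHM.
- rewrite -/(Re_eigenvalues A) -[Re_eigenvalues A]unscale.
  apply: count_dominated_scale => //.
  apply: (count_dominated_perm pM pA); apply: (count_dominatedW bound).
  rewrite addrC; exact: count_dominated_trans dMH dHA.
Qed.

End ForwardError.

(** * Measurability and parameters *)

Section Measurability.
Variable R : realType.
Local Notation C := R[i].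

(** The item of index [i] exceeds [t] exactly when at most [i] values are [<= t], and that count is
    a sum of indicators. *)
Lemma measurable_order_stat (d : measure_display) (T : measurableType d) (n i : nat)
    (lam : 'I_n -> T -> R) : (i < n)%N -> (forall j, measurable_fun setT (lam j)) ->
  measurable_fun setT
    (fun w => nth 0 (sort <=%R [seq lam j w | j <- enum 'I_n]) i).
Proof.
move=> lt_in mlam mT; apply: (measurability _ (RGenOInfty.measurableE R)) => //.
move=> /= _ [_ [t ->] <-]; rewrite preimage_itvoy.
pose low j := [set w | lam j w <= t].
have mlow j : measurable (low j).
  by rewrite -[low j]setTI; exact: (measurable_fun_le measurableT (mlam j)).
have -> : setT `&` [set w | t < nth 0 (sort <=%R [seq lam j w | j <- enum 'I_n]) i] =
    setT `&` [set w | (\sum_(j < n) \1_(low j) w : R) <= i%:R].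
  congr (_ `&` _); apply/funext => w /=; congr (is_true _).
  have lt_i : (i < size [seq lam j w | j <- enum 'I_n])%N.
    by rewrite size_map size_enum_ord.
  rewrite ltNge (nth_sort_le t lt_i) count_enumE -leqNgt -(ler_nat R).
  congr (_ <= _); rewrite -sum1_card natr_sum [LHS]big_mkcond.
  apply: eq_bigr => j _ /=; rewrite indicE inE.
  by case: ifPn => [lw|/negP lw]; [rewrite mem_set|rewrite memNset].
apply: (measurable_fun_le measurableT) => //.
by apply: measurable_sum => j; exact: measurable_indic.
Qed.

Lemma measurable_eigenvalues_within (d : measure_display) (T : measurableType d)
    (n : nat) (A : 'M[C]_n) (lam : T -> 'rV[R]_n) (eps : R) :
  (forall j, measurable_fun setT (fun w => lam w 0 j)) ->
  measurable [set w | eigenvalues_within A (lam w) eps].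
Proof.
move=> mlam; pose E i := [set w | `|nth 0 (sorted_eigenvalues A) i
  - nth 0 (sort <=%R [seq lam w 0 j | j <- enum 'I_n]) i| <= eps].
have -> : [set w | eigenvalues_within A (lam w) eps] =
    \big[setI/setT]_(i <- iota 0 n) E i.
  rewrite -bigcap_seq; apply/seteqP; split=> w /= Ew i.
    by rewrite /= mem_iota => /andP[_ lt_in]; exact: Ew.
  by move=> lt_in; apply: Ew => /=; rewrite mem_iota.
rewrite big_seq; apply: bigsetI_measurable => i; rewrite mem_iota => /andP[_ lt_in].
rewrite -[E i]setTI; apply: (measurable_fun_le measurableT); last exact: measurable_cst.
apply: measurableT_comp => //; apply: measurable_funB => //.
exact: (measurable_order_stat lt_in mlam).
Qed.

Lemma measurable_mx_Re m n (i : 'I_m) (j : 'I_n) :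
  measurable_fun setT (fun X : mx_space R m n => complex.Re (X i j)).
Proof.
move=> _ B mB; rewrite setTI; apply: sub_sigma_algebra.
by exists i, j, B; split=> //; left.
Qed.

(** The product measure integrates the measures of the sections; keeping only the points of [S]
    bounds it below by [q] times [P S]. *)
Lemma product_measure_ge (d1 d2 : measure_display) (T1 : measurableType d1)
    (T2 : measurableType d2) (P : probability T1 R) (Q : probability T2 R)
    (p q : R) (S : set T1) (E : set (T1 * T2)) :
  measurable S -> measurable E -> 0 <= q -> (p%:E <= P S)%E ->
  (forall x, S x -> (q%:E <= Q (xsection E x))%E) ->
  ((p * q)%:E <= (P \x Q) E)%E.
Proof.
move=> mS mE q0 pS qE.
apply: (@le_trans _ _ (q%:E * P S)%E).
  by rewrite mulrC EFinM lee_wpmul2l.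
rewrite -integral_cst// /product_measure1.
apply: (@le_trans _ _ (\int[P]_(x in S) Q (xsection E x))%E).
  apply: ge0_le_integral => //.
  apply: measurable_funTS; exact: measurable_fun_xsection.
apply: ge0_subset_integral => //.
exact: measurable_fun_xsection.
Qed.

End Measurability.

(** * Logarithmic estimates and numerical parameters *)

Section AccuracyBounds.
Variable R : realType.
Implicit Types n : nat.

(** Kept in the shape in which the algorithm computes it, so that [EVALSH_val] holds by
    conversion. *)
Definition delta_EIG n (eps : R) : R := 1 / 4 * (eps / 16 / 16 / (2 * n%:R ^+ 3)).

Lemma delta_EIG_E n (eps : R) : (0 < n)%N ->
  delta_EIG n eps = eps / (2048 * n%:R ^+ 3).
Proof.
by move=> n0; rewrite /delta_EIG; field; rewrite pnatr_eq0 -lt0n.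
Qed.

Lemma ln2_ge_half : 2^-1 <= ln 2 :> R.
Proof.
have := @le_ln1Dx R (- 2^-1); have -> : 1 + - 2^-1 = 2^-1 :> R by field.
by rewrite lnV ?posrE// lerN2 => -> //; lra.
Qed.

Lemma ln_ratio_ge n (eps : R) : (0 < n)%N -> 0 < eps < 1 / 2 ->
  2^-1 <= ln (n%:R / eps) /\ ln n%:R <= ln (n%:R / eps).
Proof.
move=> n0 /andP[e0 e2]; have n1 : 1 <= n%:R :> R by rewrite ler1n.
have n0' : 0 < n%:R :> R by rewrite ltr0n.
split.
  apply: le_trans ln2_ge_half _; rewrite ler_ln ?posrE ?divr_gt0//.
  by rewrite ler_pdivlMr//; lra.
by rewrite ler_ln ?posrE ?divr_gt0// ler_pdivlMr// ler_piMr//; lra.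
Qed.

(** The ratio is [2^11 n^4 / eps], at most [(n / eps)^12] since [2 <= 1 / eps] and [n >= 1]. Bounds
    in [n / delta] thus become bounds in [n / eps]. *)
Lemma ln_delta_EIG n (eps : R) : (0 < n)%N -> 0 < eps < 1 / 2 ->
  0 <= ln (n%:R / delta_EIG n eps) <= 12 * ln (n%:R / eps).
Proof.
move=> n0 /andP[e0 e2]; have n1 : 1 <= n%:R :> R by rewrite ler1n.
have n0' : 0 < n%:R :> R by rewrite ltr0n.
have -> : n%:R / delta_EIG n eps = 2 ^+ 11 * n%:R ^+ 4 / eps.
  by rewrite delta_EIG_E//; field; rewrite !gt_eqF.
have pos : 0 < 2 ^+ 11 * n%:R ^+ 4 / eps.
  by rewrite divr_gt0// mulr_gt0// exprn_gt0.
apply/andP; split.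
  apply: ln_ge0; rewrite ler_pdivlMr// mul1r.
  apply: (@le_trans _ _ 1); first by lra.
  by rewrite mulr_ege1 ?exprn_ege1//; lra.
have pos12 : 0 < (n%:R / eps) ^+ 12 by rewrite exprn_gt0// divr_gt0.
rewrite mulr_natl -lnXn ?divr_gt0// ler_ln ?posrE//.
have -> : (n%:R / eps) ^+ 12 = eps^-1 ^+ 11 * n%:R ^+ 12 / eps.
  by move: (eps^-1) => y; ring.
rewrite ler_pM2r ?invr_gt0//.
apply: ler_pM; [by rewrite exprn_ge0|by rewrite exprn_ge0| |by rewrite ler_weXn2l].
have e0' : 0 <= eps^-1 by rewrite invr_ge0 ltW.
apply: lerXn2r; rewrite ?nnegrE//.
by rewrite -[leLHS]invrK lef_pV2 ?posrE ?invr_gt0//; lra.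
Qed.

Lemma delta_EIG_itv n (eps : R) : (0 < n)%N -> 0 < eps < 1 / 2 ->
  0 < delta_EIG n eps < 1.
Proof.
move=> n0 /andP[e0 e2]; have n1 : 1 <= n%:R :> R by rewrite ler1n.
have n3 : 1 <= n%:R ^+ 3 :> R by rewrite exprn_ege1.
rewrite delta_EIG_E//; move: n3; move: (n%:R ^+ 3) => m m1.
have m0 : 0 < 2048 * m by lra.
by apply/andP; split; [exact: divr_gt0|rewrite ltr_pdivrMr//; lra].
Qed.

Lemma mul_delta_EIG_le n (eps : R) : (0 < n)%N -> 0 < eps < 1 / 2 ->
  n%:R * delta_EIG n eps <= eps / 256.
Proof.
move=> n0 /andP[e0 _]; have n1 : 1 <= n%:R ^+ 2 :> R by rewrite exprn_ege1// ler1n.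
have -> : n%:R * delta_EIG n eps = eps / 256 * (8 * n%:R ^+ 2)^-1.
  by rewrite delta_EIG_E//; field; rewrite pnatr_eq0 -lt0n.
rewrite ler_piMr ?divr_ge0 ?(ltW e0)//.
by move: (n%:R ^+ 2) n1 => m m1; rewrite invf_le1; lra.
Qed.

Lemma ln_nat_ge1 n : (18 <= n)%N -> 1 <= ln n%:R :> R.
Proof.
move=> n18; apply: (@le_trans _ _ (ln (2 ^+ 4))).
  by rewrite lnXn// -[leRHS]mulr_natl; have := ln2_ge_half; lra.
have n16 : (2 : R) ^+ 4 <= n%:R by rewrite -natrX ler_nat; lia.
by rewrite ler_ln ?posrE// (lt_le_trans _ n16).
Qed.

(** After taking logarithms, [12 L + ln K <= ln (1 / u)] suffices, where [L] is [ln (n / eps)]. For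
    [n >= 18] both [L] and [ln n] are at least 1, so [L] is below [L^4 ln n]. *)
Lemma roundoff_small n (eps u K Cb : R) : (18 <= n)%N -> 0 < eps < 1 / 2 ->
  0 < u -> 0 < K -> 0 <= ln K -> 12 + ln K <= Cb ->
  Cb * ln (n%:R / eps) ^+ 4 * ln n%:R <= ln u^-1 ->
  n%:R * (K * u) <= delta_EIG n eps.
Proof.
move=> n18 e02 u0 K0 lK CK bits; have n0 : (0 < n)%N by lia.
have [_ Ln] := ln_ratio_ge n0 e02.
have /andP[_ ld] := ln_delta_EIG n0 e02.
have /andP[d0 _] := delta_EIG_itv n0 e02.
have ln1 := ln_nat_ge1 n18.
have n0' : 0 < n%:R :> R by rewrite ltr0n.
move: Ln ld bits; set L := ln (n%:R / eps) => Ln ld bits.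
have L1 : 1 <= L by exact: le_trans Ln.
have CL : (12 + ln K) * L <= ln u^-1.
  apply: le_trans bits.
  have Cb0 : 0 <= Cb by apply: le_trans CK; lra.
  apply: (@le_trans _ _ (Cb * L)); first by rewrite ler_wpM2r//; lra.
  rewrite -[leLHS]mulr1 ler_pM//; first by rewrite mulr_ge0//; lra.
  by rewrite ler_wpM2l// -[leLHS]expr1 ler_weXn2l.
have lnK : ln (n%:R / delta_EIG n eps) + ln K <= ln u^-1.
  apply: le_trans CL; rewrite mulrDl; apply: lerD => //.
  by rewrite ler_peMr.
have nd0 : 0 < n%:R / delta_EIG n eps by exact: divr_gt0.
rewrite -lnM ?posrE// ler_ln ?posrE ?invr_gt0// in lnK; last exact: mulr_gt0.
move: lnK; rewrite -[leRHS]mul1r ler_pdivlMr//.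
have -> : n%:R / delta_EIG n eps * K * u = n%:R * (K * u) / delta_EIG n eps by ring.
by rewrite ler_pdivrMr// mul1r.
Qed.

Lemma sampler_scale_bounds n (s : R) : (0 < n)%N -> sampler_scale n s ->
  [/\ 0 < s, s <= 1 & s ^+ 2 <= (2 * n%:R)^-1].
Proof.
move=> n0; have n1 : 1 <= n%:R :> R by rewrite ler1n.
set v := (2 * n%:R)^-1.
have v0 : 0 < v by rewrite invr_gt0; lra.
have v1 : v <= 1 by rewrite invf_le1; lra.
move=> [->|->].
  by split=> //; rewrite expr2 ler_piMr// ltW.
split; first by rewrite sqrtr_gt0.
  by rewrite -[leRHS]sqrtr1 ler_wsqrtr.
by rewrite sqr_sqrtr// ltW.
Qed.

End AccuracyBounds.

(** * Value, cost and rounding error of the whole algorithm *)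

Section EvalshUnfolding.
Local Open Scope sesquilinear_scope.
Variable R : realType.
Local Notation C := R[i].

Definition scaled_input n (A : 'M[C]_n) : 'M[C]_n :=
  \matrix_(i, j) (A i j / (Phi R)%:C).

Lemma scaled_inputE n (A : 'M[C]_n) : scaled_input A = (16^-1)%:C *: A.
Proof. by apply/matrixP => i j; rewrite !mxE mulrC fmorphV. Qed.

Definition shattered (u : R) (F : fp_arith u) tN n (A Z : 'M[C]_n) (eps : R) : 'M[C]_n :=
  (SHATTERH F tN (scaled_input A) (eps / Phi R / 16) Z).1.

Lemma EVALSH_val (u : R) (F : fp_arith u) tN n
    (eig : 'M[C]_n -> R -> counted ('M[C]_n * 'rV[C]_n)) (Z A : 'M[C]_n) (eps : R) :
  (EVALSH F tN eig Z A eps).1 = \matrix_(i < 1, j < n) (Phi R *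
    complex.Re ((eig (shattered F tN A Z eps) (delta_EIG n eps)).1.2 i j)).
Proof. by []. Qed.

(** Sampling, scaling and shattering cost [tN + 4] per entry; the 7 scalar operations and the [n]
    final scalings fit in [8 n^2]. *)
Lemma EVALSH_cost (u : R) (F : fp_arith u) tN n
    (eig : 'M[C]_n -> R -> counted ('M[C]_n * 'rV[C]_n)) (Z A : 'M[C]_n) (eps : R) :
  (0 < n)%N ->
  ((EVALSH F tN eig Z A eps).2 <= (tN + 12) * (n * n)
     + (eig (shattered F tN A Z eps) (delta_EIG n eps)).2)%N.
Proof.
move=> n0.
have -> : ((EVALSH F tN eig Z A eps).2 = \sum_(i < n) \sum_(j < n) 1 + (1 + (1 +
    ((\sum_(i < n) \sum_(j < n) tN + (\sum_(i < n) \sum_(j < n) 1 +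
      (\sum_(i < n) \sum_(j < n) 1 + \sum_(i < n) \sum_(j < n) 1))) +
    (5 + ((eig (shattered F tN A Z eps) (delta_EIG n eps)).2 +
      \sum_(i < 1) \sum_(j < n) 1))))))%N by [].
rewrite !sum_nat_const !card_ord !muln1 mul1n (mulnA n n tN) [(n * n * tN)%N]mulnC.
have : (n <= n * n)%N by rewrite leq_pmulr.
move: (eig _ _).2 => k; move: (n * n)%N => m nm.
by rewrite mulnDl; lia.
Qed.

(** Prepares the call to the eigensolver: the rounding error is no larger than its own accuracy, and
    its input has norm at most 1, being below [1/16 + 14 eps / 256] plus that error. *)
Lemma shattered_error (u cN s eps : R) (F : fp_arith u) tN n (A Z G : 'M[C]_n) :
  (0 < n)%N -> 0 < eps < 1 / 2 -> 0 < u < 1 -> 0 <= cN -> 0 <= s <= 1 ->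
  opnorm A <= 1 -> opnorm G <= 7 ->
  (forall i j, normc (Z i j - G i j) <= cN * s * u) ->
  n%:R * ((99 + 16 * cN) * u) <= delta_EIG n eps ->
  let W := G + G^t* in
  [/\ opnorm W <= 14,
      opnorm (shattered F tN A Z eps - ((16^-1)%:C *: A + (eps / 256)%:C *: W))
        <= delta_EIG n eps &
      opnorm (shattered F tN A Z eps) <= 1].
Proof.
move=> n0 e02 /andP[u0 u1] cN0 /andP[s0 s1] A1 G7 ZG small W.
have /andP[d0 d1] := delta_EIG_itv n0 e02; have /andP[e0 e2] := e02.
have g01 : 0 <= eps / 256 <= 1.
  by clear - e0 e2; apply/andP; split; lra.
have u01' : 0 <= u <= 1 by rewrite (ltW u0) (ltW u1).
have ecu : cN * s * u <= cN * u by rewrite ler_wpM2r ?(ltW u0)// ler_piMr.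
have le16 : (16^-1 : R) <= 1 by rewrite invf_le1// ler1n.
have W14 : opnorm W <= 14.
  apply: le_trans (opnormD _ _) _.
  have -> : (14 : R) = 7 + 7 by rewrite -natrD.
  exact: (lerD G7 (le_trans (opnorm_adjoint _) G7)).
have A'16 : opnorm ((16^-1)%:C *: A) <= 16^-1.
  apply: le_trans (opnormZ_le _ _) _.
  by rewrite normc_real_complex ger0_norm ?ler_piMr ?invr_ge0.
have gE : eps / Phi R / 16 = eps / 256 by rewrite /Phi; field.
have err : opnorm (shattered F tN A Z eps -
    ((16^-1)%:C *: A + (eps / 256)%:C *: W)) <= delta_EIG n eps.
  apply: le_trans small; rewrite /shattered scaled_inputE gE.
  exact: (@SHATTERH_error _ u cN _ _ F tN n _ Z G u01' cN0 g01
    (le_trans A'16 le16) W14 ecu ZG).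
split; [exact: W14|exact: err|]; move: (shattered _ _ _ _ _) err => X err.
have -> : X = X - ((16^-1)%:C *: A + (eps / 256)%:C *: W)
    + ((16^-1)%:C *: A + (eps / 256)%:C *: W) by rewrite subrK.
apply: le_trans (opnormD _ _) _.
apply: (@le_trans _ _ (delta_EIG n eps + (16^-1 + eps / 256 * 14))).
  apply: (lerD err); apply: le_trans (opnormD _ _) _; apply: (lerD A'16).
  apply: le_trans (opnormZ_le _ _) _; have /andP[e256 _] := g01.
  by rewrite normc_real_complex (ger0_norm e256); exact: (ler_wpM2l e256 W14).
have n1 : 1 <= n%:R ^+ 3 :> R by rewrite exprn_ege1// ler1n.
have dle : delta_EIG n eps <= eps / 2048.
  rewrite delta_EIG_E//; move: n1; move: (n%:R ^+ 3) => m m1; clear - e0 m1.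
  by rewrite ler_pdivrMr; [rewrite mulrA divfK ?pnatr_eq0// ler_peMr// ltW|lra].
by move: dle e2; move: (delta_EIG n eps) => p; clear; lra.
Qed.

End EvalshUnfolding.

(** The output composes the jointly measurable eigensolver with the pair of shattered matrix and
    coin tosses. Measurability of the shattered matrix is assumed because rounding is an arbitrary
    function. *)
Lemma measurable_EVALSH (R : realType) (dE d : measure_display)
    (OmegaE : measurableType dE) (Omega : measurableType d)
    (EIG : eigensolver R OmegaE) (u : R) (F : fp_arith u) tN n
    (A : 'M[R[i]]_n) (eps : R) (Z : Omega -> 'M[R[i]]_n) (j : 'I_n) :
  measurable_fun setT
    ((fun p : mx_space R n n * OmegaE => EIG u F n p.1 (delta_EIG n eps) p.2)
      : _ -> mx_space R n n * mx_space R 1 n * nat)%type ->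
  measurable_fun setT
    ((fun w => shattered F tN A (Z w) eps) : Omega -> mx_space R n n) ->
  measurable_fun setT (fun w : Omega * OmegaE =>
    (EVALSH F tN (fun M delta => EIG u F n M delta w.2) (Z w.1) A eps).1 0 j).
Proof.
move=> mEIG mX.
pose f (w : Omega * OmegaE) : mx_space R n n * OmegaE :=
  (shattered F tN A (Z w.1) eps, w.2).
have mf : measurable_fun setT f.
  apply: measurable_fun_pair => //.
  exact: (measurableT_comp mX measurable_fst).
have mD : measurable_fun setT (fun w => (EIG u F n (f w).1 (delta_EIG n eps) (f w).2).1.2
    : mx_space R 1 n).
  apply: (measurableT_comp (measurable_snd (T1 := mx_space R n n))).
  apply: (measurableT_comp (measurable_fst (T2 := nat))).
  exact: (measurableT_comp mEIG mf).
under eq_fun do rewrite EVALSH_val mxE.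
apply: measurable_funM => //.
exact: (measurableT_comp (measurable_mx_Re 0 j) mD).
Qed.

(** * Assembly of the accuracy, probability and cost bounds *)

Theorem theorem4p1 (R : realType)
    (eta : R) (MM : forall n : nat, mm_prog R n)
    (dE : measure_display) (OmegaE : measurableType dE)
    (PE : probability OmegaE R) (EIG : eigensolver R OmegaE)
    (cN : R) (tN : nat) :
  0 < eta -> stable_fast_mm eta MM ->
  EIG_spec PE (fun n => mm_ops (MM n)) EIG ->
  0 <= cN ->
  exists Cbits Cops : R,
  forall (n : nat) (A : 'M[R[i]]_n) (eps u : R) (F : fp_arith u)
    (d : measure_display) (Omega : measurableType d) (P : probability Omega R)
    (s : R) (Z : Omega -> 'M[R[i]]_n),
  (0 < n)%N -> A \is hermsymmx -> opnorm A <= 1 -> 0 < eps < 1 / 2 ->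
  0 < u < 1 -> Cbits * ln (n%:R / eps) ^+ 4 * ln n%:R <= ln u^-1 ->
  sampler_scale n s -> stable_samples P cN s u Z ->
  (forall (A' : 'M[R[i]]_n) (gamma : R), measurable_fun setT
    ((fun w => (SHATTERH F tN A' gamma (Z w)).1) : Omega -> mx_space R n n)) ->
  let run (w : Omega * OmegaE) :=
    EVALSH F tN (fun M delta => EIG u F n M delta w.2) (Z w.1) A eps in
  with_prob_ge (P \x PE)%E (1 - 17 / n%:R)
    [set w | eigenvalues_within A (run w).1 eps] /\
  (forall w, ((run w).2)%:R
     <= Cops * (mm_ops (MM n))%:R * ln (n%:R / eps) ^+ 2).
Proof.
move=> _ [MMc _ _] [mEIG [Kbits [Kops EIGP]]] cN0.
pose K := 99 + 16 * cN; pose Kb := Num.max Kbits 0; pose Ko := Num.max Kops 0.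
have K1 : 1 <= K by rewrite /K; lra.
have lK0 : 0 <= ln K by exact: ln_ge0.
have Kb0 : 0 <= Kb by rewrite le_max lexx orbT.
have Ko0 : 0 <= Ko by rewrite le_max lexx orbT.
(* The powers [12 ^+ 4] and [144 = 12 ^+ 2] come from [ln (n / delta) <= 12 ln (n / eps)]. The
   summand [12 + ln K] controls roundoff, and the factor 4 uses [4 ln (n / eps)^2 >= 1]. *)
exists (12 ^+ 4 * Kb + (12 + ln K)), (4 * (tN + 12)%:R + 144 * Ko).
move=> n A eps u F d Omega P s Z n0 Ah A1 e02 u01 bits sc [_ [G Giid ZG]] mSH run.
have [Lhalf _] := ln_ratio_ge n0 e02.
have /andP[ld0 ld12] := ln_delta_EIG n0 e02.
have d01 := delta_EIG_itv n0 e02.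
have ln0 : 0 <= ln n%:R :> R by rewrite ln_ge0// ler1n.
set L := ln (n%:R / eps) in Lhalf ld12 bits *.
set del := delta_EIG n eps in ld0 ld12 d01.
have L0 : 0 <= L by apply: le_trans Lhalf; rewrite invr_ge0.
have bitsE : Kbits * ln (n%:R / del) ^+ 4 * ln n%:R <= ln u^-1.
  apply: le_trans bits; apply: ler_wpM2r => //.
  apply: (@le_trans _ _ (Kb * (12 * L) ^+ 4)).
    apply: (@le_trans _ _ (Kb * ln (n%:R / del) ^+ 4)).
      by apply: ler_wpM2r; [rewrite exprn_ge0|rewrite le_max lexx].
    by apply: ler_wpM2l => //; apply: lerXn2r; rewrite ?nnegrE// mulr_ge0.
  have -> : Kb * (12 * L) ^+ 4 = 12 ^+ 4 * Kb * L ^+ 4 by ring.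
  apply: ler_wpM2r; first exact: exprn_ge0.
  by rewrite lerDl addr_ge0.
have [EIGs EIGc] := EIGP u F n del n0 d01 u01 bitsE.
split; last first.
  move=> w; have := EVALSH_cost F tN (fun M delta => EIG u F n M delta w.2) (Z w.1) A eps n0.
  rewrite -/(run w) -(ler_nat R) => /le_trans; apply.
  rewrite natrD mulrDl mulrDl; apply: lerD.
    rewrite natrM -!mulrA mulrCA.
    have L4 : 1 <= 4 * L ^+ 2.
      have -> : 4 * L ^+ 2 = (2 * L) ^+ 2 by ring.
      by rewrite exprn_ege1//; clear - Lhalf; lra.
    apply: ler_wpM2l => //.
    have nn : (n * n)%:R <= (mm_ops (MM n))%:R :> R by rewrite ler_nat mm_ops_ge.
    by rewrite mulrCA -[leLHS]mulr1; apply: ler_pM.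
  apply: le_trans (EIGc _ _) _.
  apply: (@le_trans _ _ (Ko * (mm_ops (MM n))%:R * ln (n%:R / del) ^+ 2)).
    apply: ler_wpM2r; first exact: exprn_ge0.
    by apply: ler_wpM2r => //; rewrite le_max lexx.
  have -> : 144 * Ko * (mm_ops (MM n))%:R * L ^+ 2 =
      Ko * (mm_ops (MM n))%:R * (12 * L) ^+ 2 by ring.
  apply: ler_wpM2l; first by rewrite mulr_ge0.
  by apply: lerXn2r; rewrite ?nnegrE// mulr_ge0.
have n0' : 0 < n%:R :> R by rewrite ltr0n.
(* For [n <= 17] the claimed probability is at most 0 and the empty event serves. *)
have [n17|n18] := leqP n 17.
  exists set0; split=> //; rewrite measure0 lee_fin subr_le0.
  by rewrite ler_pdivlMr// mul1r ler_nat.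
have [s0 s1 s2] := sampler_scale_bounds n0 sc.
have [S [mS PS GS]] := gaussian_opnorm n0 s0 s2 Giid.
have small : n%:R * (K * u) <= del.
  have /andP[u0 _] := u01.
  apply: (roundoff_small n18 e02 u0 _ lK0 _ bits); first exact: lt_le_trans K1.
  by rewrite lerDr; exact: (mulr_ge0 (exprn_ge0 _ (ler0n _ _)) Kb0).
set E := [set w | _].
have mE : measurable E.
  apply: measurable_eigenvalues_within => j.
  by apply: measurable_EVALSH; [exact: mEIG|exact: mSH].
exists E; split=> //.
have n14 : 0 <= 1 - 14 / n%:R :> R.
  by rewrite subr_ge0 ler_pdivrMr// mul1r ler_nat; exact: leq_trans n18.
(* With [v = 1 / n], the product is [1 - 17 v + 42 v^2]. *)
apply: (@le_trans _ _ ((1 - 3 / n%:R) * (1 - 14 / n%:R))%:E).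
  rewrite lee_fin; have : 0 <= (n%:R^-1 : R) ^+ 2 by exact: sqr_ge0.
  by move: (n%:R^-1); clear=> v v2; nra.
apply: (product_measure_ge mS mE n14 PS) => w Sw.
have s01 : 0 <= s <= 1 by rewrite (ltW s0).
have [W14 Xerr X1] := @shattered_error R u cN s eps F tN n A (Z w) (G w) n0 e02 u01 cN0
  s01 A1 (GS w Sw) (ZG w) small.
(* For a fixed good sample [w], the eigensolver's success event on this input lies in the section of
   [E] at [w]. *)
have [S' [mS' S'sub PS']] := EIGs _ X1.
apply: le_trans PS' _; apply: le_measure; rewrite ?inE//.
  exact: measurable_xsection.
move=> w' S'w'; apply: mem_set; change (eigenvalues_within A (run (w, w')).1 eps).
have e256 : 256 * (eps / 256) = eps by field.
rewrite /run EVALSH_val -[X in eigenvalues_within _ _ X]e256.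
apply: (eigenvalues_within_perturbation n0 Ah (hermsymmx_symmetrize (G w)) W14 _ _ Xerr).
- by have /andP[e0 _] := e02; exact: (divr_ge0 (ltW e0) (ler0n _ _)).
- exact: mul_delta_EIG_le.
- exact: S'sub.
Qed.
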